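(* Let $p$ be a prime, $\delta>0$, and let $\omega,R:\mathbb{N}\to\mathbb{N}$ be non-decreasing functions with $\omega(d)\geq \delta^{-2/3}p^d$ and $R(d)\geq 2(d+1+\log_p(\delta^{-1/3}))$ for all $d$. Then for every sufficiently large $n$ there exists a function $f:\mathbb{F}_p^n\to[0,1]$ such that, if $\mathcal{B}$ is a $(\delta,\omega,R)$-quadratic regularity partition for $f$, then $\mathcal{B}[1]$ is a partition into cosets of a subspace of codimension at least $\mathrm{twr}(\lfloor \delta^{-1/3}/(60p)\rfloor-1)$.
   Context: Write $e(t)=e_p(t)=\exp(2\pi it/p)$ for $t\in\mathbb{F}_p$. A quadratic factor $\mathcal{B}$ of complexity $D$ is given by polynomials $P_1,\dots,P_D:\mathbb{F}_p^n\to\mathbb{F}_p$ of degree at most 2; it is the partition of $\mathbb{F}_p^n$ into the simultaneous level sets $\{x:(P_1(x),\dots,P_D(x))=c\}$, $c\in\mathbb{F}_p^D$, called atoms. The linear layer $\mathcal{B}[1]$ is the coarser factor defined by those $P_i$ of degree 1; it is a partition of $\mathbb{F}_p^n$ into cosets of a subspace. If $Q_1,\dots,Q_q$ are the $P_i$ of degree exactly 2, the rank of $\mathcal{B}$ is $\min_{\lambda\in\mathbb{F}_p^q\setminus\{0\}}\mathrm{rank}(\sum_i\lambda_iQ_i)$, where the rank of a quadratic polynomial $Q$ is the matrix rank of the unique $n\times n$ matrix $M$ over $\mathbb{F}_p$ such that $Q(x)=x^TMx+L(x)$ for a linear polynomial $L$ (rank is infinite if $q=0$). $\mathbb{E}(f|\mathcal{B})(x)$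 is the average of $f$ on the atom containing $x$. The Gowers $U^3$-norm of $g:\mathbb{F}_p^n\to\mathbb{C}$ is given by $\|g\|_{U^3}^8=\mathbb{E}_{x,h_1,h_2,h_3}\prod_{\omega\in\{0,1\}^3}\mathcal{C}^{|\omega|}g(x+\omega_1h_1+\omega_2h_2+\omega_3h_3)$, $\mathcal{C}$ denoting complex conjugation. Given $\delta>0$ and non-decreasing $\omega,R$, a quadratic factor $\mathcal{B}$ of complexity $D$ is a $(\delta,\omega,R)$-quadratic regularity partition for $f:\mathbb{F}_p^n\to[0,1]$ if its rank is at least $R(D)$ and there is $f_{err}:\mathbb{F}_p^n\to[-1,1]$ with $\|f_{err}\|_{L_2}<\delta$ and $\|f-\mathbb{E}(f|\mathcal{B})-f_{err}\|_{U^3}<1/\omega(D)$. $\mathrm{twr}(0)=1$, $\mathrm{twr}(i+1)=2^{\mathrm{twr}(i)}$. *)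

(* Defs.v *)
From HB Require Import structures.
From mathcomp Require Import all_boot all_order all_algebra.
From mathcomp Require Import all_classical all_reals all_analysis.
From mathcomp Require Import complex.
(* The notations of mpoly clash with those of mathcomp-analysis. *)
From mathcomp.multinomials Require Import -(notations) mpoly.
Set Implicit Arguments.
Unset Strict Implicit.
Unset Printing Implicit Defensive.
Import Order.TTheory GRing.Theory Num.Theory.
Local Open Scope ring_scope.

Definition avg (K : fieldType) (T : finType) (F : T -> K) : K :=
  (\sum_t F t) / #|T|%:R.

Section Factors.
Variables (p n : nat).
Local Notation V := 'rV['F_p]_n.

(* The degree is that of the function V -> 'F_p, i.e. the least degree of a
   polynomial inducing it; over 'F_2 the function x_i ^ 2 thus has degree 1. *)
Definition degree_le (d : nat) (P : V -> 'F_p) : Prop :=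
  exists2 q : mpoly n 'F_p, (msize q <= d.+1)%N
    & forall x, P x = meval (x ord0) q.

Definition degree_eq (d : nat) (P : V -> 'F_p) : Prop :=
  degree_le d P /\ forall e, (e < d)%N -> ~ degree_le e P.

(* A factor of complexity D is a family of functions V -> 'F_p indexed by 'I_D;
   other finite index types occur for its linear and quadratic layers. *)
Definition quadratic_factor (I : finType) (P : I -> V -> 'F_p) : Prop :=
  forall i, degree_le 2 (P i).

Definition layer (d : nat) (I : finType) (P : I -> V -> 'F_p) :
    {i : I | `[< degree_eq d (P i) >]} -> V -> 'F_p :=
  fun i => P (val i).

Definition atom (I : finType) (P : I -> V -> 'F_p) (x : V) : {set V} :=
  [set y | [forall i, P i y == P i x]].

Definition atoms (I : finType) (P : I -> V -> 'F_p) : {set {set V}} :=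
  [set atom P x | x : V].

Definition cosets (W : {vspace V}) : {set {set V}} :=
  [set [set x + w | w in W] | x : V].

Definition codim (W : {vspace V}) : nat := (n - \dim W)%N.

Definition represents (M : 'M['F_p]_n) (Q : V -> 'F_p) : Prop :=
  exists2 L : V -> 'F_p, degree_le 1 L
    & forall x, Q x = (x *m M *m x^T) ord0 ord0 + L x.

(* For odd p, M is the unique symmetric matrix representing Q.  For p = 2 such a
   symmetric matrix need not exist, and the matrix of Q is taken to be that of
   its polar form (x, y) |-> Q (x + y) - Q x - Q y + Q 0, which does not depend
   on the representing matrix A. *)
Definition quad_mx (Q : V -> 'F_p) (M : 'M['F_p]_n) : Prop :=
  if odd p then M^T = M /\ represents M Q
  else exists2 A, represents A Q & M = A + A^T.

Definition quad_rank (Q : V -> 'F_p) : nat :=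
  \rank (xget 0 [set M | quad_mx Q M]%classic).

Variable R : realType.

(* The infimum of the empty set is +oo, so the rank is infinite when there is
   no polynomial of degree exactly 2. *)
Definition factor_rank (I : finType) (P : I -> V -> 'F_p) : \bar R :=
  ereal_inf [set (quad_rank (fun x => \sum_i lam i * @layer 2 I P i x))%:R%:E |
    lam in [set lam : {ffun {i : I | `[< degree_eq 2 (P i) >]} -> 'F_p} |
             lam != 0]]%classic.

Definition cond_exp (f : V -> R) (I : finType) (P : I -> V -> 'F_p) (x : V) : R :=
  (\sum_(y in atom P x) f y) / #|atom P x|%:R.

Definition L2norm (f : V -> R) : R := Num.sqrt (avg (fun x => `|f x| ^+ 2)).

(* The average below is a nonnegative real number; Re only changes its type. *)
Definition U3norm (g : V -> R[i]) : R :=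
  complex.Re (avg (fun xh : V * {ffun 'I_3 -> V} =>
    \prod_(w : {ffun 'I_3 -> bool})
      iter (\sum_j w j) Num.conj (g (xh.1 + \sum_j xh.2 j *+ w j))))
  `^ (8%:R^-1).

Definition quadratic_regularity_partition (delta : R) (omega rho : nat -> nat)
    (f : V -> R) (D : nat) (P : 'I_D -> V -> 'F_p) : Prop :=
  [/\ quadratic_factor P,
      ((rho D)%:R%:E <= factor_rank P)%E
    & exists f_err : V -> R,
        [/\ forall x, -1 <= f_err x <= 1,
            L2norm f_err < delta
          & U3norm (fun x => (f x - cond_exp f P x - f_err x)%:C%C)
              < (omega D)%:R^-1]].

End Factors.

Arguments layer {p n} d {I} P i.

(* The recursion twr (i + 1) = 2 ^ twr i and twr 0 = 1 force twr (-1) = 0. *)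
Definition twr (i : int) : nat :=
  if i is Posz k then iter k (expn 2) 1%N else 0%N.

(* Main.v *)
Require Import Defs.
From mathcomp Require Import all_boot all_order all_algebra.
From mathcomp Require Import all_classical all_reals all_analysis.
From mathcomp Require Import complex ring lra zify.
From mathcomp Require Import mxabelem.
From mathcomp.multinomials Require Import -(notations) mpoly.
Set Implicit Arguments.
Unset Strict Implicit.
Unset Printing Implicit Defensive.
Import Order.TTheory GRing.Theory Num.Theory.
Local Open Scope ring_scope.

(** The coordinates are cut into consecutive blocks, the size of each being
    exponential in the total size of the previous ones.  For every value v of the
    first i blocks choose a linear form xi_i(v) on the next block, so that each
    nonzero vector of that block is annihilated by at most 7/8 of the forms, and
    let f be the average over 2t layers of the indicators of xi_i(x).x = 0.

    Suppose that the subspace W of B[1] meets a block, and let i be the first one,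
    with u in W nonzero there.  Set T(x) = e(xi_i(x).x) if xi_i(x).u <> 0, and
    T(x) = 0 otherwise.  On every atom of B the function T is a constant multiple
    of a single character, nontrivial on W.  Expanding the indicators of atoms into
    quadratic phases, the rank condition makes T almost orthogonal to E(f|B), and
    the U^3 condition makes it almost orthogonal to f - E(f|B) - f_err.  But T
    correlates with f: translating x inside the block of xi_i or xi_j shows that
    every layer j <> i contributes zero and layer i a positive amount.  Hence W
    meets none of the blocks, whose total size is of tower type in t. *)

(** * Normalised averages over a finite type *)

Section Average.
Variables (K : numFieldType) (T : finType).
Implicit Types (F G : T -> K) (c : K).

Lemma eq_avg F G : F =1 G -> avg F = avg G.
Proof. by move=> FG; rewrite /avg (eq_bigr G). Qed.

Lemma avgD F G : avg (fun t => F t + G t) = avg F + avg G.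
Proof. by rewrite /avg big_split mulrDl. Qed.

Lemma avgMl c F : avg (fun t => c * F t) = c * avg F.
Proof. by rewrite /avg -mulr_sumr mulrA. Qed.

Lemma avg_sum (I : Type) (r : seq I) (P : pred I) (F : I -> T -> K) :
  avg (fun t => \sum_(i <- r | P i) F i t) = \sum_(i <- r | P i) avg (F i).
Proof. by rewrite /avg exchange_big mulr_suml. Qed.

Lemma avg_bij (s : T -> T) F : bijective s -> avg (F \o s) = avg F.
Proof. by move=> sK; rewrite /avg [in RHS](reindex s) //; exact: onW_bij. Qed.

(** An injective self-map of a finite type permutes it, so the average equals [c] times itself. The
    orthogonality relations below rest on this. *)
Lemma avg_eq0_shift (s : T -> T) c F :
  injective s -> (forall t, F (s t) = c * F t) -> c != 1 -> avg F = 0.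
Proof.
move=> sI Fs c1; have : avg F = c * avg F.
  by rewrite -avgMl -(avg_bij F (injF_bij sI)); exact: eq_avg.
move/eqP; rewrite -subr_eq0 -{1}[avg F]mul1r -mulrBl mulf_eq0 subr_eq0.
by rewrite eq_sym (negPf c1) => /eqP.
Qed.

Lemma ler_avg F G : (forall t, F t <= G t) -> avg F <= avg G.
Proof.
move=> FG; rewrite /avg ler_wpM2r ?invr_ge0 ?ler0n//.
by apply: ler_sum => t _; exact: FG.
Qed.

Lemma avg_ge0 F : (forall t, 0 <= F t) -> 0 <= avg F.
Proof. by move=> F0; rewrite divr_ge0 ?ler0n// sumr_ge0. Qed.

Lemma ler_norm_avg F : `|avg F| <= avg (fun t => `|F t|).
Proof.
rewrite /avg normrM normfV (ger0_norm (ler0n _ _)) ler_wpM2r ?invr_ge0 ?ler0n//.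
exact: ler_norm_sum.
Qed.

Hypothesis T_gt0 : (0 < #|T|)%N.

Lemma avg_cst c : avg (fun _ : T => c) = c.
Proof.
rewrite /avg sumr_const -[c *+ _]mulr_natr mulfK// pnatr_eq0.
by rewrite -lt0n.
Qed.

(** The variance is nonnegative. *)
Lemma sqr_avg_le F : (forall t, F t \is Num.real) ->
  (avg F) ^+ 2 <= avg (fun t => F t ^+ 2).
Proof.
move=> Fr; have mr : avg F \is Num.real.
  by rewrite realM ?realV ?realn// sum_real.
have : 0 <= avg (fun t => (F t - avg F) ^+ 2).
  by apply: avg_ge0 => t; rewrite -realEsqr realB.
suff -> : avg (fun t => (F t - avg F) ^+ 2)
  = avg (fun t => F t ^+ 2) - avg F ^+ 2 by rewrite subr_ge0.
pose m := avg F; transitivity (avg (fun t => F t ^+ 2 + (- (2 * m) * F t + m ^+ 2))).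
  by apply: eq_avg => t; rewrite -/m; ring.
by rewrite !avgD avgMl avg_cst -/m; ring.
Qed.

Lemma expr2n_avg_le k F : (forall t, 0 <= F t) ->
  (avg F) ^+ (2 ^ k) <= avg (fun t => F t ^+ (2 ^ k)).
Proof.
move=> F0; elim: k => [|k IH]; first by rewrite expr1.
rewrite expnSr exprM.
apply: (@le_trans _ _ (avg (fun t => F t ^+ (2 ^ k)) ^+ 2)).
  by rewrite ler_sqr ?nnegrE ?exprn_ge0 ?avg_ge0// => t; rewrite exprn_ge0.
apply: le_trans (sqr_avg_le _) _ => [t|].
  by rewrite realX// ger0_real.
by apply: ler_avg => t; rewrite -exprM.
Qed.

End Average.

(** * Gowers norms and polynomial phases *)

Section GowersNorm.
Variables (C : numClosedFieldType) (V : finZmodType) (A : zmodType).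
Variable e : A -> C.
Hypothesis e_add : {morph e : a b / a + b >-> a * b}.
Hypothesis e_norm : forall a, `|e a| = 1.

Let V_gt0 : (0 < #|V|)%N. Proof. by apply/card_gt0P; exists 0. Qed.

Lemma char_neq0 a : e a != 0.
Proof. by rewrite -normr_eq0 e_norm oner_neq0. Qed.

Lemma char0 : e 0 = 1.
Proof. by apply: (mulfI (char_neq0 0)); rewrite -e_add addr0 mulr1. Qed.

Lemma charN a : e (- a) = (e a)^*.
Proof.
apply: (mulfI (char_neq0 a)).
by rewrite -e_add subrr char0 -normCK e_norm expr1n.
Qed.

(** Writing the second variable of the double average as [x + h] gives the differencing step behind
    both the Gowers inequality and the Gauss sum bound. *)
Lemma sqr_norm_avg (g : V -> C) :
  `|avg g| ^+ 2 = avg (fun h => avg (fun x => g x * (g (x + h))^*)).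
Proof.
transitivity (avg (fun x => g x * (avg g)^*)).
  by rewrite normCK mulrC -avgMl; apply: eq_avg => x; rewrite mulrC.
have -> : avg (fun x => g x * (avg g)^*)
    = avg (fun x => avg (fun h => g x * (g (x + h))^*)).
  apply: eq_avg => x; rewrite avgMl; congr (_ * _).
  rewrite -(@avg_bij _ _ (fun h => x + h) g); last first.
    by exists (fun h => h - x) => h; rewrite ?subrKC// addrAC subrr add0r.
  by rewrite /avg rmorphM rmorph_sum fmorphV rmorph_nat.
rewrite /avg -[in RHS]mulr_suml exchange_big.
by rewrite -[in LHS]mulr_suml.
Qed.

(** For positive k this is the power 2^k of the U^k-norm, built from multiplicative derivatives to
    suit induction; [gowersE] recovers the average over cubes. *)
Fixpoint gowers k (g : V -> C) : C :=
  if k is k'.+1 then avg (fun h => gowers k' (fun x => g x * (g (x + h))^*))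
  else avg g.

(** Polynomials of degree at most k in the sense of additive derivatives. The sign of the difference
    matches the derivative in [gowers]. *)
Fixpoint poly_phase k (phi : V -> A) : Prop :=
  if k is k'.+1 then forall h, poly_phase k' (fun x => phi x - phi (x + h))
  else forall x y, phi x = phi y.

Lemma poly_phaseD k phi psi : poly_phase k phi -> poly_phase k psi ->
  poly_phase k (fun x => phi x + psi x).
Proof.
elim: k phi psi => [|k IH] phi psi /= Hf Hg.
  by move=> x y; rewrite (Hf x y) (Hg x y).
move=> h; have := IH _ _ (Hf h) (Hg h).
by congr poly_phase; apply/funext => x; rewrite opprD addrACA.
Qed.

(** Squaring and differencing replaces [g] by its derivative and lowers the degree of the phase by
    one; convexity of the remaining power moves it inside the average over h. *)
Lemma gowers_correlation k (g : V -> C) phi : poly_phase k phi ->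
  `|avg (fun x => g x * e (phi x))| ^+ (2 ^ k.+1) <= gowers k.+1 g.
Proof.
elim: k g phi => [|k IH] g phi Hphi.
  rewrite -[gowers 1 g]sqr_norm_avg.
  rewrite (_ : avg _ = e (phi 0) * avg g).
    by rewrite normrM e_norm mul1r.
  rewrite -avgMl; apply: eq_avg => x.
  by rewrite (Hphi x 0) mulrC.
rewrite expnS exprM sqr_norm_avg.
pose G h := avg (fun x => g x * (g (x + h))^* * e (phi x - phi (x + h))).
have -> : avg (fun h => avg (fun x => g x * e (phi x) *
    (g (x + h) * e (phi (x + h)))^*)) = avg G.
  apply: eq_avg => h; apply: eq_avg => x.
  by rewrite rmorphM /= -charN mulrACA e_add.
(* As a squared modulus, [avg G] is real and nonnegative; only then is it comparable with the
   average of the moduli of [G h]. *)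
have avgG_ge0 : 0 <= avg G.
  have -> : avg G = `|avg (fun x => g x * e (phi x))| ^+ 2.
    rewrite sqr_norm_avg; apply: eq_avg => h; apply: eq_avg => x.
    by rewrite rmorphM /= -charN mulrACA e_add.
  by rewrite exprn_ge0.
apply: (@le_trans _ _ (avg (fun h => `|G h|) ^+ (2 ^ k.+1))).
  have Gle : avg G <= avg (fun h => `|G h|).
    by rewrite -[leLHS](ger0_norm avgG_ge0) ler_norm_avg.
  by apply: lerXn2r Gle; rewrite nnegrE//; apply: avg_ge0.
apply: le_trans (expr2n_avg_le V_gt0 _ _) _ => //.
by apply: ler_avg => h; apply: IH; exact: Hphi.
Qed.

End GowersNorm.

(** * Averages over pairs and cubes *)

Section AverageProduct.
Variable K : numFieldType.

Lemma avg_pair (S T : finType) (F : S * T -> K) :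
  avg F = avg (fun s => avg (fun t => F (s, t))).
Proof.
rewrite /avg card_prod natrM invfM mulrA -[in RHS]mulr_suml mulrAC.
by rewrite pair_bigA; congr (_ / _ / _); apply: eq_bigr => -[].
Qed.

Lemma avg_exchange (S T : finType) (F : S -> T -> K) :
  avg (fun s => avg (F s)) = avg (fun t => avg (fun s => F s t)).
Proof. by rewrite /avg -!mulr_suml exchange_big mulrAC. Qed.

Definition ffun_cons (T : Type) k (a : T) (h : {ffun 'I_k -> T}) :
    {ffun 'I_k.+1 -> T} :=
  [ffun j => if unlift ord0 j is Some i then h i else a].

Lemma ffun_cons0 (T : Type) k (a : T) (h : {ffun 'I_k -> T}) :
  ffun_cons a h ord0 = a.
Proof. by rewrite ffunE unlift_none. Qed.

Lemma ffun_consS (T : Type) k (a : T) (h : {ffun 'I_k -> T}) i :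
  ffun_cons a h (lift ord0 i) = h i.
Proof. by rewrite ffunE liftK. Qed.

Lemma big_ffun_recl (R : Type) (idx : R) (op : Monoid.com_law idx)
    (T : finType) k (F : {ffun 'I_k.+1 -> T} -> R) :
  \big[op/idx]_h F h
  = \big[op/idx]_a \big[op/idx]_(h : {ffun 'I_k -> T}) F (ffun_cons a h).
Proof.
rewrite pair_bigA /=.
rewrite (reindex (fun ah : T * {ffun 'I_k -> T} => ffun_cons ah.1 ah.2)) //=.
exists (fun h => (h ord0, [ffun j => h (lift ord0 j)])) => [[a h]|h] _ /=.
  by rewrite ffun_cons0; congr pair; apply/ffunP => j; rewrite ffunE ffun_consS.
apply/ffunP => j; case: (unliftP ord0 j) => [i|] ->.
  by rewrite ffun_consS ffunE.
by rewrite ffun_cons0.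
Qed.

Lemma avg_ffun_recl (T : finType) k (F : {ffun 'I_k.+1 -> T} -> K) :
  avg F = avg (fun a => avg (fun h : {ffun 'I_k -> T} => F (ffun_cons a h))).
Proof.
rewrite /avg big_ffun_recl -[in RHS]mulr_suml !card_ffun !card_ord expnSr.
by rewrite natrM invfM mulrA.
Qed.

End AverageProduct.

(** The first coordinate of the cube is the outermost derivative: its two values give [g] and the
    conjugated translate of [g]. *)
Lemma gowersE (C : numClosedFieldType) (V : finZmodType) k (g : V -> C) :
  gowers k g = avg (fun xh : V * {ffun 'I_k -> V} =>
    \prod_(w : {ffun 'I_k -> bool})
      iter (\sum_j w j) Num.conj (g (xh.1 + \sum_j xh.2 j *+ w j))).
Proof.
elim: k g => [|k IH] g.
  rewrite avg_pair; apply: eq_avg => x.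
  rewrite -[LHS](@avg_cst _ {ffun 'I_0 -> V}) ?card_ffun ?card_ord//.
  apply: eq_avg => h /=.
  rewrite (big_pred1 [ffun=> false]); first by rewrite !big_ord0 addr0.
  by move=> w; symmetry; apply/eqP/ffunP => -[].
rewrite /= avg_pair.
under [RHS]eq_avg do rewrite avg_ffun_recl.
rewrite [RHS]avg_exchange; apply: eq_avg => a.
rewrite IH avg_pair; apply: eq_avg => x; apply: eq_avg => h /=.
rewrite big_ffun_recl big_bool /= mulrC -big_split /=.
apply: eq_bigr => w _.
rewrite !big_ord_recl !ffun_cons0.
have -> : (\sum_(i < k) ffun_cons true w (lift ord0 i) = \sum_i w i)%N.
  by apply: eq_bigr => i _; rewrite ffun_consS.
have -> : (\sum_(i < k) ffun_cons false w (lift ord0 i) = \sum_i w i)%N.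
  by apply: eq_bigr => i _; rewrite ffun_consS.
have sumE b : \sum_(i < k) ffun_cons a h (lift ord0 i) *+ ffun_cons b w (lift ord0 i)
    = \sum_i h i *+ w i by apply: eq_bigr => i _; rewrite !ffun_consS.
rewrite !sumE mulr0n add0r mulr1n add0n addrA addnC.
rewrite iterD /=.
rewrite [x + a + _]addrAC.
by elim: (\sum_i w i)%N => //= m ->; rewrite rmorphM.
Qed.

Lemma U3norm_gowers (R : realType) p n (g : 'rV['F_p]_n -> R[i]) :
  U3norm g = complex.Re (gowers 3 g) `^ (8%:R^-1).
Proof. by rewrite gowersE. Qed.

(** The easy direction of the inverse theory of the U^3-norm: quadratic phases are obstructions to
    uniformity. *)
Lemma U3norm_correlation (R : realType) p n (e : 'F_p -> R[i])
    (g : 'rV['F_p]_n -> R[i]) phi :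
  {morph e : a b / a + b >-> a * b} -> (forall a, `|e a| = 1) ->
  poly_phase 2 phi ->
  `|avg (fun x => g x * e (phi x))| <= (U3norm g)%:C%C.
Proof.
move=> eD eN phi2; have := gowers_correlation eD eN g phi2.
rewrite U3norm_gowers; set G := gowers 3 g; set a := avg _.
rewrite (normc_def a); set r := Num.sqrt _ => /= aG.
have r0 : 0 <= r by rewrite sqrtr_ge0.
have {aG} : r ^+ 8 <= complex.Re G.
  by move: aG; rewrite -rmorphXn /= lecE /= => /andP[].
move=> rG; rewrite lecR.
have -> : r = (r ^+ 8) `^ 8%:R^-1.
  by rewrite -powR_mulrn// -powRrM mulfV ?pnatr_eq0// powRr1.
have r80 : 0 <= r ^+ 8 by rewrite exprn_ge0.
by rewrite ge0_ler_powR ?invr_ge0 ?ler0n// nnegrE (le_trans r80 rG).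
Qed.

Lemma avg_indicator (K : numFieldType) (T : finType) (A : {pred T}) :
  avg (fun t => (t \in A)%:R) = #|A|%:R / #|T|%:R :> K.
Proof.
rewrite /avg -natr_sum; congr (_%:R / _).
by rewrite -sum1_card [RHS]big_mkcond; apply: eq_bigr => t _; case: ifP.
Qed.

(** * Characters of the prime field and their orthogonality *)

Section Character.
Variable p : nat.
Hypothesis p_pr : prime p.

(* A root of unity is taken instead of exp (2 i pi / p): any nontrivial character
   will do. *)
Lemma exists_character (C : numClosedFieldType) :
  exists e : 'F_p -> C, [/\ {morph e : a b / a + b >-> a * b},
    forall a, `|e a| = 1 & forall a, e a = 1 -> a = 0].
Proof.
have p_gt1 := prime_gt1 p_pr.
(* A root of 1 + X + ... + X^(p-1) is a p-th root of unity, different from 1 because the value at 1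
   is p. *)
have [z /rootP] : exists z : C, root (\poly_(i < p) 1) z.
  apply/closed_rootP; rewrite size_poly_eq ?oner_neq0//.
  by apply: contraTneq p_gt1 => ->.
rewrite horner_poly => z_sum.
have zp : z ^+ p = 1.
  apply/eqP; rewrite -subr_eq0 subrX1.
  suff -> : \sum_(i < p) z ^+ i = 0 by rewrite mulr0.
  by rewrite -[RHS]z_sum; apply: eq_bigr => i _; rewrite mul1r.
have z1 : z != 1.
  apply/eqP => z1; move: z_sum; rewrite z1.
  under eq_bigr do rewrite expr1n mul1r.
  rewrite sumr_const card_ord => /eqP.
  by rewrite pnatr_eq0 -leqn0 leqNgt prime_gt0.
have zN : `|z| = 1.
  apply/eqP; rewrite -(pexpr_eq1 (prime_gt0 p_pr)) ?normr_ge0//.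
  by rewrite -normrX zp normr1.
exists (fun a => z ^+ (a : nat)); split.
- move=> a b; rewrite -exprD /= [X in (_ %% X)%N]Fp_cast//.
  by rewrite {2}(divn_eq (a + b) p) exprD mulnC exprM zp expr1n mul1r.
- by move=> a; rewrite normrX zN expr1n.
move=> a /eqP za; apply/eqP; apply: contraT => a0.
have az : coprime (a : nat) p.
  rewrite coprime_sym prime_coprime//; apply/negP => /dvdn_leq.
  have -> : (0 < a)%N by rewrite lt0n.
  move/(_ isT); rewrite leqNgt; apply/negP/negPn.
  by rewrite -[ltnRHS](Fp_cast p_pr) ltn_ord.
case/eqP: z1; have /eqP e1 := za.
have a_gt0 : (0 < a)%N by rewrite lt0n.
(* Bezout: z^a = 1 and z^p = 1 with a prime to p force z = 1. *)
case: (egcdnP p a_gt0) => u v uv _.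
have : z ^+ (u * a) = z ^+ (v * p + gcdn a p) by rewrite uv.
by rewrite mulnC exprM e1 expr1n (eqP az) exprD mulnC exprM zp expr1n mul1r.
Qed.

Variables (C : numClosedFieldType) (e : 'F_p -> C).
Hypothesis e_add : {morph e : a b / a + b >-> a * b}.
Hypothesis e_norm : forall a, `|e a| = 1.
Hypothesis e_inj : forall a, e a = 1 -> a = 0.

Lemma avg_charM (y : 'F_p) : avg (fun a => e (a * y)) = (y == 0)%:R.
Proof.
have [->|y0] := eqVneq y 0.
  under eq_avg do rewrite mulr0 (char0 e_add e_norm).
  by rewrite avg_cst//; apply/card_gt0P; exists 0.
apply: (@avg_eq0_shift _ _ (fun a => a + 1) (e y)).
- exact: addIr.
- by move=> a; rewrite mulrDl mul1r e_add mulrC.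
by apply/eqP => /e_inj/eqP; rewrite (negPf y0).
Qed.

Lemma avg_char_ffun (I : finType) (c : {ffun I -> 'F_p}) :
  avg (fun mu : {ffun I -> 'F_p} => e (\sum_i mu i * c i)) = (c == 0)%:R.
Proof.
have [->|c0] := eqVneq c 0.
  rewrite -[RHS](@avg_cst _ {ffun I -> 'F_p}); last by apply/card_gt0P; exists 0.
  apply: eq_avg => mu; rewrite big1 ?(char0 e_add e_norm)// => i _.
  by rewrite ffunE mulr0.
have [i ci] : exists i, c i != 0.
  apply/existsP; apply: contraR c0 => /existsPn ci; apply/eqP/ffunP => i.
  by rewrite ffunE; apply/eqP/negPn.
pose s (mu : {ffun I -> 'F_p}) := mu + [ffun j => (j == i)%:R].
apply: (@avg_eq0_shift _ _ s (e (c i))).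
- exact: addIr.
- move=> mu; rewrite -e_add; congr e.
  under eq_bigr do rewrite /s !ffunE mulrDl.
  rewrite big_split addrC; congr (_ + _).
  by rewrite (bigD1 i)//= eqxx mul1r big1 ?addr0// => j /negPf ->; rewrite mul0r.
by apply/eqP => /e_inj/eqP; rewrite (negPf ci).
Qed.

End Character.

(** * The standard bilinear form *)

Section Dot.
Variables (F : fieldType) (n : nat).
Implicit Types x y z : 'rV[F]_n.

Definition dot x y : F := (x *m y^T) 0 0.

Lemma dotDl x y z : dot (x + y) z = dot x z + dot y z.
Proof. by rewrite /dot mulmxDl mxE. Qed.

Lemma dotDr x y z : dot z (x + y) = dot z x + dot z y.
Proof. by rewrite /dot linearD mulmxDr mxE. Qed.

Lemma dotZr a x y : dot x (a *: y) = a * dot x y.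
Proof. by rewrite /dot linearZ -scalemxAr mxE. Qed.

Lemma dot0l y : dot 0 y = 0.
Proof. by rewrite /dot mul0mx mxE. Qed.

Lemma dot_delta x i : dot x (delta_mx 0 i) = x 0 i.
Proof. by rewrite /dot trmx_delta -colE mxE. Qed.

Lemma dotE x y : dot x y = \sum_i x 0 i * y 0 i.
Proof. by rewrite /dot mxE; apply: eq_bigr => i _; rewrite mxE. Qed.

Lemma exists_dot_eq1 x : x != 0 -> exists i, dot x ((x 0 i)^-1 *: delta_mx 0 i) = 1.
Proof.
move=> x0; have [i xi] : exists i, x 0 i != 0.
  apply/existsP; apply: contraR x0 => /existsPn xi; apply/eqP/rowP => i.
  by rewrite mxE; apply/eqP/negPn.
by exists i; rewrite dotZr dot_delta mulVf.
Qed.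

End Dot.

(** * Gauss sums of quadratic phases *)

Section GaussSum.
Variables (p n : nat).
Hypothesis p_pr : prime p.
Local Notation V := 'rV['F_p]_n.
Variables (C : numClosedFieldType) (e : 'F_p -> C).
Hypothesis e_add : {morph e : a b / a + b >-> a * b}.
Hypothesis e_norm : forall a, `|e a| = 1.
Hypothesis e_inj : forall a, e a = 1 -> a = 0.

Lemma card_V_gt0 : (0 < #|{: V}|)%N.
Proof. by apply/card_gt0P; exists 0. Qed.

Lemma avg_char_dot (y : V) : avg (fun x => e (dot y x)) = (y == 0)%:R.
Proof.
have [->|y0] := eqVneq y 0.
  under eq_avg do rewrite dot0l (char0 e_add e_norm).
  by rewrite avg_cst// card_V_gt0.
have [i yi] := exists_dot_eq1 y0.
apply: (@avg_eq0_shift _ _ (fun x => x + (y 0 i)^-1 *: delta_mx 0 i) (e 1)).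
- exact: addIr.
- by move=> x; rewrite dotDr yi e_add mulrC.
by apply/eqP => /e_inj/eqP; rewrite oner_eq0.
Qed.

(** After squaring and differencing, the inner average over x vanishes unless [h *m M] is 0, and the
    kernel of [M] has density p^(-rank M). *)
Lemma gauss_sum (phi : V -> 'F_p) (M : 'M['F_p]_n) (c : V -> 'F_p) :
  (forall x h, phi (x + h) - phi x = dot (h *m M) x + c h) ->
  `|avg (e \o phi)| ^+ 2 <= (p%:R ^+ \rank M)^-1.
Proof.
move=> phiM.
have SE : `|avg (e \o phi)| ^+ 2
    = avg (fun h => (e (c h))^* * (h *m M == 0)%:R).
  rewrite sqr_norm_avg; apply: eq_avg => h.
  rewrite -[(_ == 0)%:R]conjC_nat -avg_char_dot.
  rewrite /avg rmorphM rmorph_sum fmorphV rmorph_nat !mulrA; congr (_ / _).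
  rewrite mulr_sumr; apply: eq_bigr => x _ /=.
  rewrite -!(charN e_add e_norm) -!e_add -opprD; congr e.
  by rewrite [c h + _]addrC -phiM opprB.
have -> : `|avg (e \o phi)| ^+ 2 = Num.norm (`|avg (e \o phi)| ^+ 2).
  by rewrite normrX normr_id.
rewrite SE; apply: le_trans (ler_norm_avg _) _.
have -> : avg (fun h => `|(e (c h))^* * (h *m M == 0)%:R|)
    = avg (fun h => (h \in rowg (kermx M))%:R : C).
  apply: eq_avg => h; rewrite normrM norm_conjC e_norm mul1r normr_nat inE.
  by rewrite (sameP sub_kermxP eqP).
rewrite avg_indicator card_rowg card_mx card_Fp// mul1n mxrank_ker.
have -> : (p ^ n = p ^ (n - \rank M) * p ^ \rank M)%N.
  by rewrite -expnD subnK// rank_leq_row.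
rewrite natrM invfM mulrA natrX.
by rewrite mulfV ?mul1r ?natrX// expf_neq0// pnatr_eq0 -lt0n prime_gt0.
Qed.

End GaussSum.

(** * Polynomials of degree at most two *)

Section Degree.
Variables (p n : nat).
Local Notation V := 'rV['F_p]_n.
Implicit Types (phi psi P : V -> 'F_p).

Lemma poly_phase0 k : @poly_phase V 'F_p k (fun=> 0).
Proof.
elim: k => //= k IH h.
by rewrite (_ : (fun _ => _) = (fun=> 0))//; apply/funext => x; rewrite subrr.
Qed.

Lemma poly_phaseZ k a phi : poly_phase k phi -> poly_phase k (fun x => a * phi x).
Proof.
elim: k phi => [|k IH] phi /= Hphi; first by move=> x y; rewrite (Hphi x y).
move=> h; have := IH _ (Hphi h).
by congr poly_phase; apply/funext => x; rewrite mulrBr.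
Qed.

Lemma poly_phase_sum k (I : Type) (r : seq I) (phi : I -> V -> 'F_p) :
  (forall i, poly_phase k (phi i)) -> poly_phase k (fun x => \sum_(i <- r) phi i x).
Proof.
move=> Hphi; elim: r => [|i r IH].
  by under eq_fun do rewrite big_nil; exact: poly_phase0.
by under eq_fun do rewrite big_cons; exact: poly_phaseD.
Qed.

Lemma poly_phaseS k phi : poly_phase k phi -> poly_phase k.+1 phi.
Proof.
elim: k phi => [|k IH] phi Hphi h; last by apply: IH; exact: Hphi.
by move=> x y; rewrite !(Hphi _ 0).
Qed.

Lemma poly_phase_affine phi : poly_phase 1 phi ->
  forall x h, phi (x + h) - phi x = phi h - phi 0.
Proof.
move=> phi1 x h; have /= := phi1 h 0 x; rewrite add0r => E.
by rewrite -[LHS]opprB -E opprB.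
Qed.

Lemma poly_phase_dot (y : V) : poly_phase 1 (dot y).
Proof. by move=> h x x'; rewrite !dotDr; ring. Qed.

Lemma mnm_coordD (m : multinom n) k : mdeg m = k.+1 ->
  exists i m', m = mnm_add (mnm1 i) m' /\ mdeg m' = k.
Proof.
move=> mk; have [i mi] : exists i, m i != 0%N.
  apply/existsP; apply: contra_eqT mk => /existsPn m0.
  rewrite eq_sym (_ : mdeg m = 0%N)//; apply/eqP; rewrite mdeg_eq0.
  by apply/eqP/mnmP => j; rewrite mnm0E; apply/eqP/negPn.
have E : m = mnm_add (mnm1 i) (mnm_sub m (mnm1 i)).
  by rewrite addmC submK// lep1mP.
exists i, (mnm_sub m (mnm1 i)); split=> //.
by apply/eqP; rewrite -eqSS -mk {2}E mdegD mdeg1.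
Qed.

Lemma poly_phase_monomial (m : multinom n) k : (k <= 2)%N -> (mdeg m <= k)%N ->
  poly_phase k (fun x : V => meval (x ord0) (mpolyX 'F_p m)).
Proof.
move=> k2 mk.
have le_phase j phi : (j <= k)%N -> poly_phase j phi -> poly_phase k phi.
  elim: k {k2 mk} => [|k IH]; first by rewrite leqn0 => /eqP->.
  rewrite leq_eqVlt => /orP[/eqP->//|]; rewrite ltnS => jk /(IH jk).
  exact: poly_phaseS.
apply: le_phase (mk) _.
have : (mdeg m <= 2)%N by exact: leq_trans mk k2.
case E: (mdeg m) => [|[|[|]]]// _.
- have -> : m = mnm0 by apply/eqP; rewrite -mdeg_eq0 E.
  by rewrite mpolyX0 => x y; rewrite !meval1.
- move/eqP: E; rewrite mdeg_eq1 => /existsP[i /eqP ->].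
  by move=> h x y; rewrite !mevalXU !mxE; ring.
have [i [m' [-> /eqP]]] := mnm_coordD E.
rewrite mdeg_eq1 => /existsP[j /eqP ->] h h' x y.
by rewrite mpolyXD !mevalM !mevalXU !mxE; ring.
Qed.

Lemma degree_le_phase k P : (k <= 2)%N -> degree_le k P -> poly_phase k P.
Proof.
move=> k2 [q qk Pq].
(* The guard on [mdeg m] makes every term a phase, as [poly_phase_sum] asks for all indices and not
   only for monomials of the support. *)
rewrite (_ : P = fun x => \sum_(m <- msupp q) mcoeff m q *
    (if (mdeg m <= k)%N then meval (x ord0) (mpolyX 'F_p m) else 0)); last first.
  apply/funext => x; rewrite Pq mevalE big_seq [RHS]big_seq.
  apply: eq_bigr => m /msize_mdeg_lt mq.
  by rewrite (leq_trans mq qk : (mdeg m <= k)%N) mevalX.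
apply: poly_phase_sum => m; apply: poly_phaseZ.
by case mk: (mdeg m <= k)%N; [exact: poly_phase_monomial|exact: poly_phase0].
Qed.

(** The derivative of a form with matrix A has matrix A + A^T. For odd p this is 2M, of the same
    rank because 2 is invertible; for p = 2 it is [M] itself. *)
Lemma quad_mx_diff (Q : V -> 'F_p) M : prime p -> quad_mx Q M ->
  exists N (c : V -> 'F_p), \rank N = \rank M /\
    forall x h, Q (x + h) - Q x = dot (h *m N) x + c h.
Proof.
move=> p_pr.
have diff A : represents A Q -> exists c : V -> 'F_p,
    forall x h, Q (x + h) - Q x = dot (h *m (A + A^T)) x + c h.
  case=> L /(degree_le_phase (isT : 1 <= 2)%N)/poly_phase_affine L1 QA.
  exists (fun h => dot (h *m A) h + (L h - L 0)) => x h.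
  have symA (y z : V) : (y *m A *m z^T) 0 0 = dot (z *m A^T) y.
    have E : (y *m A *m z^T)^T = z *m A^T *m y^T.
      by rewrite !trmx_mul trmxK mulmxA.
    by rewrite /dot -E [RHS]mxE.
  have BDr (y z w : V) : (y *m A *m (z + w)^T) 0 0
      = (y *m A *m z^T) 0 0 + (y *m A *m w^T) 0 0.
    by rewrite linearD mulmxDr mxE.
  have BDl (y z w : V) : ((z + w) *m A *m y^T) 0 0
      = (z *m A *m y^T) 0 0 + (w *m A *m y^T) 0 0.
    by rewrite !mulmxDl mxE.
  rewrite !QA -(L1 x) BDl !BDr.
  by rewrite mulmxDr dotDl -symA /dot; ring.
rewrite /quad_mx; case: ifP => [p_odd [MT /diff[c Hc]]|_ [A /diff[c Hc] ->]].
  exists (M + M^T), c; split=> //; rewrite MT -mulr2n -scaler_nat.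
  apply: mxrank_scale_nz.
  rewrite -(dvdn_pcharf (pchar_Fp p_pr)).
  by rewrite dvdn_prime2//; apply: contraTneq p_odd => ->.
by exists (A + A^T), c.
Qed.

End Degree.

(** * Correlation with the atoms of a quadratic factor *)

Section FactorCorrelation.
Variables (p n : nat).
Hypothesis p_pr : prime p.
Local Notation V := 'rV['F_p]_n.
Variables (C : numClosedFieldType) (e : 'F_p -> C).
Hypothesis e_add : {morph e : a b / a + b >-> a * b}.
Hypothesis e_norm : forall a, `|e a| = 1.
Hypothesis e_inj : forall a, e a = 1 -> a = 0.

(* The indicator of an atom is the average of p ^ #|I| quadratic phases, so a
   function that is a single character on each atom is controlled by
   correlations with quadratic phases. *)
Lemma factor_correlation (I : finType) (P : I -> V -> 'F_p)
    (F g : V -> C) (xi : V -> V) (B : C) :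
  0 <= B ->
  (forall x y, (forall i, P i x = P i y) -> F x = F y /\ xi x = xi y) ->
  (forall x, `|F x| <= 1) ->
  (forall x (mu : {ffun I -> 'F_p}), F x != 0 ->
    `|avg (fun z => g z * e (\sum_i mu i * P i z + dot (xi x) z))| <= B) ->
  `|avg (fun x => F x * g x * e (dot (xi x) x))| <= p%:R ^+ #|I| * B.
Proof.
move=> B0 FP F1 HB.
pose Pf x := [ffun i => P i x].
(* An empty level set gets the representative 0; its term is zero anyway, since no x satisfies
   [Pf x == c]. *)
pose rep c := odflt 0 [pick y | Pf y == c].
pose G c x := F (rep c) * ((Pf x == c)%:R * (g x * e (dot (xi (rep c)) x))).
have -> : avg (fun x => F x * g x * e (dot (xi x) x))
    = \sum_c avg (G c).
  rewrite -avg_sum; apply: eq_avg => x.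
  rewrite (bigD1 (Pf x))//= big1 ?addr0; last first.
    by move=> c /negPf cx; rewrite /G eq_sym cx mul0r mulr0.
  have [Fx xix] : F (rep (Pf x)) = F x /\ xi (rep (Pf x)) = xi x.
    apply: FP => i; rewrite /rep; case: pickP => [y /eqP/ffunP/(_ i)|].
      by rewrite !ffunE.
    by move/(_ x); rewrite eqxx.
  by rewrite /G Fx xix eqxx mul1r mulrA.
apply: le_trans (ler_norm_sum _ _ _) _.
have -> : p%:R ^+ #|I| * B = \sum_(c : {ffun I -> 'F_p}) B.
  by rewrite sumr_const card_ffun card_Fp// -natrX mulr_natl.
apply: ler_sum => c _; rewrite avgMl normrM.
have [->|Fc] := eqVneq (F (rep c)) 0; first by rewrite normr0 mul0r.
rewrite -[leRHS]mul1r; apply: ler_pM => //.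
have -> : avg (fun x => (Pf x == c)%:R * (g x * e (dot (xi (rep c)) x)))
  = avg (fun mu : {ffun I -> 'F_p} => avg (fun x => e (- \sum_i mu i * c i) *
      (g x * e (\sum_i mu i * P i x + dot (xi (rep c)) x)))).
  rewrite avg_exchange; apply: eq_avg => x.
  rewrite -subr_eq0 -(avg_char_ffun e_add e_norm e_inj) mulrC -avgMl.
  apply: eq_avg => mu.
  have -> : \sum_i mu i * (Pf x - c) i
      = \sum_i mu i * P i x - \sum_i mu i * c i.
    by rewrite -sumrB; apply: eq_bigr => i _; rewrite !ffunE mulrBr.
  by rewrite !e_add; ring.
apply: le_trans (ler_norm_avg _) _.
rewrite -[leRHS](@avg_cst _ {ffun I -> 'F_p}); last by apply/card_gt0P; exists 0.
apply: ler_avg => mu; rewrite avgMl normrM e_norm mul1r.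
exact: HB.
Qed.

(** Positive rank rules out the default 0 of [xget], so the matrix really belongs to [Q]; adding [r]
    changes the derivative only by a term independent of x. *)
Lemma affine_gauss_sum (Q r : V -> 'F_p) : (0 < quad_rank Q)%N ->
  poly_phase 1 r ->
  `|avg (fun x => e (Q x + r x))| ^+ 2 <= (p%:R ^+ quad_rank Q)^-1.
Proof.
rewrite /quad_rank; case: xgetP => [M _ /= QM _|_]; last by rewrite mxrank0.
move=> /poly_phase_affine r1; have [N [c [<- Qc]]] := quad_mx_diff p_pr QM.
apply: (@gauss_sum _ _ p_pr _ _ e_add e_norm e_inj (fun x => Q x + r x) N
  (fun h => c h + (r h - r 0))) => x h.
by rewrite addrA -Qc -(r1 x); ring.
Qed.

(** If [mu] vanishes on the polynomials of degree exactly 2, translation by [u] multiplies the phase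
    by e(y.u), which is not 1, and the average is 0. Otherwise the rank of the factor bounds a Gauss
    sum. *)
Lemma quadratic_factor_gauss_sum (R : realType) (I : finType)
    (P : I -> V -> 'F_p) (r : nat) (mu : {ffun I -> 'F_p}) (y u : V) :
  quadratic_factor P -> (r%:R%:E <= factor_rank R P)%E -> (0 < r)%N ->
  (forall i z, degree_le 1 (P i) -> P i (z + u) = P i z) -> dot y u != 0 ->
  `|avg (fun z => e (\sum_i mu i * P i z + dot y z))| ^+ 2 <= (p%:R ^+ r)^-1.
Proof.
move=> P2 Pr r0 Pu yu.
have deg1 i : ~ degree_eq 2 (P i) -> degree_le 1 (P i).
  move=> Pi2; apply: contrapT => Pi1; apply: Pi2; split; first exact: P2.
  move=> k k2 [q qk qP]; apply: Pi1; exists q => //.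
  exact: leq_trans qk k2.
pose lam := [ffun j : {i : I | `[< degree_eq 2 (P i) >]} => mu (val j)].
have [lam0|lam0] := eqVneq lam 0.
  rewrite (_ : avg _ = 0) ?normr0 ?expr0n//= ?invr_ge0 ?exprn_ge0 ?ler0n//.
  apply: (@avg_eq0_shift _ _ (fun z => z + u) (e (dot y u))).
  - exact: addIr.
  - move=> z; rewrite -e_add; congr e.
    rewrite dotDr [RHS]addrC addrA; congr (_ + _ + _).
    apply: eq_bigr => i _; have [/asboolP Pi|/deg1/Pu->//] := pselect (degree_eq 2 (P i)).
    by have /ffunP/(_ (Sub i Pi)) := lam0; rewrite !ffunE /= => ->; rewrite !mul0r.
  by apply: contra_neq yu => /e_inj.
pose Q x := \sum_i lam i * layer 2 P i x.
pose L x := \sum_(i | ~~ `[< degree_eq 2 (P i) >]) mu i * P i x + dot y x.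
have rQ : (r <= quad_rank Q)%N.
  rewrite -(ler_nat R) -lee_fin; apply: le_trans Pr _.
  by apply: ereal_inf_lbound; exists lam.
have -> : avg (fun z => e (\sum_i mu i * P i z + dot y z))
    = avg (fun z => e (Q z + L z)).
  apply: eq_avg => z; rewrite addrA; congr (e (_ + _)).
  rewrite (bigID (fun i => `[< degree_eq 2 (P i) >])) /=; congr (_ + _).
  pose I2 := {i : I | `[< degree_eq 2 (P i) >]}.
  rewrite [LHS](@reindex_omap _ _ _ I I2 val insub) /=; last first.
    by move=> i Pi; rewrite insubT.
  by apply: eq_big => j; [rewrite valK eqxx (valP j)|rewrite ffunE].
have L1 : poly_phase 1 L.
  apply: poly_phaseD (poly_phase_dot _).
  suff : poly_phase 1 (fun x => \sum_i (if ~~ `[< degree_eq 2 (P i) >]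
      then mu i else 0) * (if ~~ `[< degree_eq 2 (P i) >] then P i x else 0)).
    congr poly_phase; apply/funext => x; rewrite [RHS]big_mkcond.
    by apply: eq_bigr => i _; case: ifP; rewrite ?mul0r.
  apply: poly_phase_sum => i; apply: poly_phaseZ.
  case: asboolP => Pi; first exact: poly_phase0.
  exact: degree_le_phase (deg1 _ Pi).
apply: le_trans (affine_gauss_sum _ L1) _; first exact: leq_trans rQ.
rewrite lef_pV2 ?posrE ?exprn_gt0 ?ltr0n ?prime_gt0//.
by rewrite ler_weXn2l// ler1n prime_gt0.
Qed.

End FactorCorrelation.

(** * A random linear code *)

Section Code.
Variable p : nat.
Hypothesis p_pr : prime p.

Lemma leq_exp2rW m k N : (m <= k)%N -> (m ^ N <= k ^ N)%N.
Proof. by case: N => // N; rewrite leq_exp2r. Qed.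

(* Markov's inequality for a random family, with the weight 4 ^ #|zeros|. *)
Lemma exists_random_code (S : finType) d : (p ^ (8 * d) <= 8 ^ #|S|)%N ->
  exists xi : S -> 'rV['F_p]_d, forall u, u != 0 ->
    (#|S| <= 8 * #|[set s | dot (xi s) u != 0%R]|)%N.
Proof.
move=> pS; set N := #|S|.
pose w (a : 'F_p) := if a == 0 then 4 else 1%N.
pose W (xi : {ffun S -> 'rV['F_p]_d}) (u : 'rV_d) := (\prod_s w (dot (xi s) u))%N.
have card_rV : #|{: 'rV['F_p]_d}| = (p ^ d)%N by rewrite card_mx card_Fp// mul1n.
(* Translation by [v] maps the hyperplane orthogonal to [u] into its complement, so at most half of
   the vectors have weight 4 and the mean weight is at most 5/2. *)
have sum_w (u : 'rV['F_p]_d) : u != 0 -> (2 * \sum_y w (dot y u) <= 5 * p ^ d)%N.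
  move=> u0; have [i ui] := exists_dot_eq1 u0; set v := _ *: _ in ui.
  have vu : dot v u = 1.
    by rewrite -[RHS]ui !dotE; apply: eq_bigr => k _; rewrite mulrC.
  pose A := [set y : 'rV['F_p]_d | dot y u == 0].
  have AA : (#|A| <= #|~: A|)%N.
    rewrite -(card_imset _ (addIr v)); apply/subset_leq_card/fintype.subsetP => y.
    case/imsetP => x; rewrite !inE => /eqP xu ->.
    by rewrite dotDl vu xu add0r oner_eq0.
  rewrite (bigID (mem A)) /=.
  rewrite (eq_bigr (fun=> 4)); last by move=> y; rewrite inE /w => ->.
  rewrite [X in (_ + X)%N](eq_bigr (fun=> 1%N)); last first.
    by move=> y; rewrite inE /w => /negPf ->.
  rewrite sum_nat_const [X in (_ + X)%N](_ : _ = #|~: A|); last first.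
    by rewrite -sum1_card; apply: eq_bigl => y; rewrite !inE.
  by have := cardsC A; rewrite card_rV; move: AA; lia.
(* The mean of [W] over all families factorises over [S], hence is at most (5/2)^N for each of the
   p^d - 1 nonzero u. *)
have [xi xiW] : exists xi, (2 ^ N * \sum_(u | u != 0%R) W xi u < p ^ d * 5 ^ N)%N.
  apply: contrapT => /forallNP H.
  have : (\sum_(xi : {ffun S -> 'rV['F_p]_d}) p ^ d * 5 ^ N
      <= 2 ^ N * \sum_(u : 'rV['F_p]_d | u != 0%R) \sum_xi W xi u)%N.
    rewrite exchange_big big_distrr /=; apply: leq_sum => xi _.
    by rewrite leqNgt; apply/negP/H.
  apply/negP; rewrite -ltnNge.
  rewrite sum_nat_const card_ffun card_rV -/N.
  apply: (@leq_ltn_trans ((p ^ d).-1 * (5 * p ^ d) ^ N)%N); last first.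
    rewrite mulnCA [((p ^ d) ^ N * _)%N]mulnC -expnMn.
    have pd : (0 < p ^ d)%N by rewrite expn_gt0 prime_gt0.
    have pN : (0 < (5 * p ^ d) ^ N)%N by rewrite expn_gt0 muln_gt0 pd.
    by rewrite (ltn_pmul2r pN) prednK.
  have -> : (p ^ d).-1 = #|[pred u : 'rV['F_p]_d | u != 0]|.
    by rewrite -card_rV (cardD1 0) /=; apply: eq_card => u; rewrite !inE andbT.
  rewrite -sum_nat_const big_distrr /=; apply: leq_sum => u u0.
  rewrite -(bigA_distr_bigA (fun _ y => w (dot y u))) /= prod_nat_const -/N.
  by rewrite -expnMn leq_exp2rW ?sum_w.
exists xi => u u0; rewrite leqNgt; apply/negP => wt.
pose z := #|[pred s | dot (xi s) u == 0]|.
have zN : (z + #|[set s | dot (xi s) u != 0%R]|)%N = N.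
  by rewrite cardsE /z; have := cardC [pred s | dot (xi s) u == 0].
have Wz : W xi u = (4 ^ z)%N.
  rewrite /W (bigID (fun s => dot (xi s) u == 0)) /=.
  rewrite [X in (_ * X)%N]big1 ?muln1; last by move=> s /negPf; rewrite /w => ->.
  rewrite (eq_bigr (fun=> 4)); last by move=> s; rewrite /w => ->.
  by rewrite prod_nat_const.
(* Contradiction after taking eighth powers: z > 7N/8 makes the left side at least 2^(22N), while
   the right side is at most (8 * 5^8)^N, and 8 * 5^8 <= 2^22. *)
have {xiW} : (2 ^ N * 4 ^ z < p ^ d * 5 ^ N)%N.
  apply: leq_ltn_trans xiW; rewrite leq_mul2l -Wz (bigD1 u)//= leq_addr.
  exact: orbT.
rewrite -(ltn_exp2r _ _ (isT : 0 < 8)%N) !expnMn -!expnM.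
apply/negP; rewrite -leqNgt.
apply: (@leq_trans (8 ^ N * 5 ^ (N * 8))%N).
  by rewrite leq_mul2r [(d * 8)%N]mulnC pS orbT.
rewrite [(N * 8)%N]mulnC expnM -expnMn.
apply: (@leq_trans ((2 ^ 22) ^ N)%N).
  have E : (8 * 5 ^ 8 <= 2 ^ 22)%N by lia.
  exact: leq_exp2rW.
rewrite -(expnM 2 2) -!expnM -expnD leq_exp2l//.
by move: wt zN; rewrite -/N; lia.
Qed.

End Code.

(** * Tower growth of the total block size *)

Fixpoint layer_dim i : nat :=
  if i is i'.+1 then (layer_dim i' + 2 ^ (layer_dim i' - 3))%N else 0%N.

Lemma layer_dim_mono i j : (i <= j)%N -> (layer_dim i <= layer_dim j)%N.
Proof.
elim: j => [|j IH]; first by rewrite leqn0 => /eqP ->.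
rewrite leq_eqVlt => /orP[/eqP->//|]; rewrite ltnS => /IH/leq_trans; apply.
exact: leq_addr.
Qed.

(** Two blocks pay for one exponential: from a total D >= 6 the first adds at least 3, which cancels
    the loss in the exponent, and the second then adds at least 2^D. *)
Lemma twr_layer_dim (t : nat) : (twr (t%:Z - 1) <= layer_dim (2 * t))%N.
Proof.
case: t => [|[|[|t]]]//.
have -> : t.+3%:Z - 1 = t.+2%:Z by lia.
suff : (6 <= layer_dim (2 * t.+3))%N /\ (twr t.+2%:Z <= layer_dim (2 * t.+3))%N.
  by case.
elim: t => [|t [IH6 IH]]; first by [].
have layer_dimS i : layer_dim i.+1 = (layer_dim i + 2 ^ (layer_dim i - 3))%N by [].
have -> : (2 * t.+4 = (2 * t.+3).+2)%N by lia.
move: (2 * t.+3)%N IH6 IH => m IH6 IH; rewrite !layer_dimS.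
move: (layer_dim _) IH6 IH => D IH6 IH.
split; first by rewrite -addnA (leq_trans IH6)// leq_addr.
have D3 : (3 <= 2 ^ (D - 3))%N.
  apply: (@leq_trans (2 ^ 3)%N) => //; rewrite leq_exp2l//; lia.
apply: (@leq_trans (2 ^ D)%N); first by rewrite /= leq_exp2l.
apply: leq_trans (leq_addl _ _); rewrite leq_exp2l//.
move: (2 ^ (D - 3))%N D3 => q D3; lia.
Qed.

(** * Codes placed on consecutive blocks *)

Section Layers.
Variable p : nat.
Hypothesis p_pr : prime p.

(** In dimension one the constant form 1 detects every nonzero u. Otherwise the zero forms of a
    random code, which detect nothing, are replaced by a nonzero one. *)
Lemma exists_code (S : finType) d : (0 < d)%N ->
  d = 1%N \/ (p ^ (8 * d) <= 8 ^ #|S|)%N ->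
  exists xi : S -> 'rV['F_p]_d, (forall s, xi s != 0) /\
    forall u, u != 0 -> (#|S| <= 8 * #|[set s | dot (xi s) u != 0%R]|)%N.
Proof.
case: d => // d _.
have one0 : const_mx 1 != 0 :> 'rV['F_p]_d.+1.
  by apply/eqP => /rowP/(_ ord0); rewrite !mxE => /eqP; rewrite oner_eq0.
case=> [[d0]|/(exists_random_code p_pr)[xi xiP]].
  subst d; exists (fun=> const_mx 1); split=> [//|u u0].
  rewrite (_ : [set s | _] = [set: S]) ?cardsT ?leq_pmull//.
  apply/setP => s; rewrite !inE dotE big_ord1 mxE mul1r.
  apply: contraNN u0 => /eqP u0; apply/eqP/rowP => i.
  by rewrite ord1 mxE u0.
exists (fun s => if xi s == 0 then const_mx 1 else xi s); split=> [s|u u0].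
  by case: ifPn.
apply: leq_trans (xiP u u0) _; rewrite leq_mul2l; apply/subset_leq_card.
apply/fintype.subsetP => s; rewrite !inE.
by have [->|//] := eqVneq (xi s) 0; rewrite dot0l eqxx.
Qed.

(** The last condition is a code distance: the words [dot (xi x) u], indexed by x, form a linear
    code on the block with relative distance at least 1/8. *)
Definition block_code (n D d : nat) (xi : 'rV['F_p]_n -> 'rV['F_p]_n) : Prop :=
  [/\ forall x y : 'rV_n, (forall k : 'I_n, (k < D)%N -> x 0 k = y 0 k) -> xi x = xi y,
      forall (x : 'rV_n) (k : 'I_n), xi x 0 k != 0 -> (D <= k < D + d)%N,
      forall x, xi x != 0
    & forall (u : 'rV_n) (k : 'I_n), (D <= k < D + d)%N -> u 0 k != 0 ->
        (#|{: 'rV['F_p]_n}| <= 8 * #|[set x | dot (xi x) u != 0%R]|)%N].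

(** The code is indexed by the first D coordinates and padded with zeros. Densities survive since
    all prefixes have equally many extensions. *)
Lemma exists_block_code n D d : (D + d <= n)%N -> (0 < d)%N ->
  d = 1%N \/ (p ^ (8 * d) <= 8 ^ (p ^ D))%N ->
  exists xi, @block_code n D d xi.
Proof.
move=> /subnKC; rewrite -addnA; move: (n - _)%N => r <- {n} d0 dp.
have cardD : #|{: 'rV['F_p]_D}| = (p ^ D)%N by rewrite card_mx card_Fp// mul1n.
have [|c [c0 cP]] := @exists_code 'rV['F_p]_D d d0; first by rewrite cardD.
exists (fun x => row_mx 0 (row_mx (c (lsubmx x)) 0)); split.
- move=> x y xy; congr (row_mx 0 (row_mx (c _) 0)); apply/rowP => k.
  by rewrite !mxE; apply: xy => /=.
- move=> x k; rewrite mxE; case: (splitP k) => [j _|j ->]; rewrite mxE ?eqxx//.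
  case: splitP => [i ->|i _]; rewrite ?mxE ?eqxx// => _.
  by rewrite leq_addr ltn_add2l ltn_ord.
- move=> x; apply/eqP => /rowP xi0; case/eqP: (c0 (lsubmx x)).
  apply/rowP => k; have := xi0 (rshift D (lshift r k)).
  by rewrite row_mxEr row_mxEl !mxE.
move=> u k kD uk; pose v := lsubmx (rsubmx u).
have dotv (x : 'rV_(D + (d + r))) :
    dot (row_mx 0 (row_mx (c (lsubmx x)) 0)) u = dot (c (lsubmx x)) v.
  rewrite /dot -[in LHS](hsubmxK u) -[in LHS](hsubmxK (rsubmx u)).
  by rewrite !tr_row_mx !mul_row_col !mul0mx addr0 add0r.
have v0 : v != 0.
  apply/eqP => v0; case/eqP: uk.
  have kDd : (k - D < d)%N by move: kD; lia.
  have /rowP/(_ (Ordinal kDd)) := v0; rewrite !mxE => <-.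
  by congr (u _ _); apply: val_inj => /=; move: kD; lia.
pose A := [set a | dot (c a) v != 0%R].
have -> : [set x | dot (row_mx 0 (row_mx (c (lsubmx x)) 0)) u != 0%R]
    = [set row_mx ab.1 ab.2 | ab in finset.setX A [set: 'rV['F_p]_(d + r)]].
  apply/setP => x; rewrite inE dotv; apply/idP/imsetP => [xA|[[a b]]].
    exists (lsubmx x, rsubmx x) => /=; last by rewrite hsubmxK.
    by rewrite !inE /= xA.
  by rewrite !inE /= => /andP[ab _] ->; rewrite row_mxKl.
rewrite card_imset; last by move=> [a b] [a' b'] /= /eq_row_mx[-> ->].
rewrite cardsX cardsT mulnA [X in (X <= _)%N]card_mx mul1n expnD.
rewrite [#|{: 'rV['F_p]_(d + r)}|]card_mx mul1n leq_mul2r; apply/orP; right.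
by apply: leq_trans (cP v v0); rewrite card_mx mul1n.
Qed.

(** This fixes the block size: 8 * 2^(D-3) is 2^D, and p^(2^D) <= 2^(p 2^D) <= 8^(p^D). For D <= 3
    truncated subtraction gives a block of size one. *)
Lemma code_rate D : (2 ^ (D - 3) = 1)%N \/
  (p ^ (8 * 2 ^ (D - 3)) <= 8 ^ (p ^ D))%N.
Proof.
have [D3|D3] := leqP D 3; first by left; move: D3; rewrite -subn_eq0 => /eqP ->.
right; rewrite -(expnD 2 3) subnKC ?(ltnW D3)//.
apply: (@leq_trans ((2 ^ p) ^ (2 ^ D))%N).
  by rewrite leq_exp2rW// ltnW// ltn_expl.
rewrite -(expnM 2 3) -expnM leq_exp2l//.
case: D D3 => // D _; rewrite !expnS.
rewrite [(3 * _)%N]mulnCA leq_mul2l; apply/orP; right.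
apply: leq_mul => //; apply: leq_exp2rW; exact: prime_gt1.
Qed.

Lemma exists_layers n s : (layer_dim s <= n)%N ->
  exists xi : nat -> 'rV['F_p]_n -> 'rV['F_p]_n, forall i, (i < s)%N ->
    block_code (layer_dim i) (2 ^ (layer_dim i - 3)) (xi i).
Proof.
move=> sn; have /choice[xi xiP] : forall i, exists xi : 'rV['F_p]_n -> 'rV_n,
    (i < s)%N -> block_code (layer_dim i) (2 ^ (layer_dim i - 3)) xi.
  move=> i; have [si|si] := boolP (i < s)%N; last by exists id.
  have [|||xi xiP] := @exists_block_code n (layer_dim i) (2 ^ (layer_dim i - 3)).
  - exact: leq_trans (layer_dim_mono si) sn.
  - by rewrite expn_gt0.
  - exact: code_rate.
  by exists xi.
by exists xi.
Qed.

End Layers.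

(** * Correlations between layers *)

Section LayerCorrelation.
Variables (p n : nat).
Hypothesis p_pr : prime p.
Local Notation V := 'rV['F_p]_n.
Variables (C : numClosedFieldType) (e : 'F_p -> C).
Hypothesis e_add : {morph e : a b / a + b >-> a * b}.
Hypothesis e_norm : forall a, `|e a| = 1.
Hypothesis e_inj : forall a, e a = 1 -> a = 0.

(** Move x inside the block by a vector w with xi(x).w = 1. The form [xi x] does not see the move,
    and w depends on x only through [xi x], whence injectivity. *)
Lemma block_code_shift (D d : nat) (xi : V -> V) : block_code D d xi ->
  exists s : V -> V, [/\ injective s,
    forall x (k : 'I_n), ~~ (D <= k < D + d)%N -> s x 0 k = x 0 k
  & forall x, dot (xi x) (s x) = dot (xi x) x + 1].
Proof.
move=> [xi_eq xi_supp xi0 _].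
pose w (v : V) : V := if [pick k | v 0 k != 0] is Some k
  then (v 0 k)^-1 *: delta_mx 0 k else 0.
have wP x : exists2 k, xi x 0 k != 0 & w (xi x) = (xi x 0 k)^-1 *: delta_mx 0 k.
  rewrite /w; case: pickP => [k xik|v0]; first by exists k.
  by case/eqP: (xi0 x); apply/rowP => k; rewrite mxE; apply/eqP/negPn/negbT/v0.
pose s x := x + w (xi x).
have s_id x (j : 'I_n) : ~~ (D <= j < D + d)%N -> s x 0 j = x 0 j.
  move=> jD; have [k xik wk] := wP x; rewrite /s wk !mxE eqxx /=.
  case: eqP => [jk|_]; last by rewrite mulr0 addr0.
  by case/negP: jD; rewrite jk (xi_supp x).
have s_lt x (j : 'I_n) : (j < D)%N -> s x 0 j = x 0 j.
  by move=> jD; apply: s_id; rewrite leqNgt jD.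
exists s; split=> // [x y sxy|x]; last first.
  by have [k xik wk] := wP x; rewrite dotDr wk dotZr dot_delta mulVf.
have xixy : xi x = xi y.
  by apply: xi_eq => j jD; rewrite -s_lt// sxy s_lt.
by move: sxy; rewrite /s xixy => /addIr.
Qed.

Lemma dot_eq_on (D d : nat) (xi : V -> V) (x y z : V) : block_code D d xi ->
  (forall k : 'I_n, (D <= k < D + d)%N -> y 0 k = z 0 k) ->
  dot (xi x) y = dot (xi x) z.
Proof.
move=> [_ xi_supp _ _] yz; rewrite !dotE; apply: eq_bigr => k _.
have [->|/xi_supp/yz->//] := eqVneq (xi x 0 k) 0; by rewrite !mul0r.
Qed.

Lemma char1_neq1 a : a != 0 -> e a != 1.
Proof. by apply: contra_neq => /e_inj. Qed.

Lemma block_code_mean0 (D d : nat) (xi : V -> V) (H : V -> C) c :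
  block_code D d xi -> c != 0 ->
  (forall x y, xi x = xi y ->
    (forall k : 'I_n, ~~ (D <= k < D + d)%N -> x 0 k = y 0 k) -> H x = H y) ->
  avg (fun x => H x * e (c * dot (xi x) x)) = 0.
Proof.
move=> xiP c0 HP; have [s [s_inj s_id sD]] := block_code_shift xiP.
have xis x : xi (s x) = xi x.
  have [xi_eq _ _ _] := xiP; apply: xi_eq => k kD; rewrite s_id//.
  by rewrite leqNgt kD.
apply: (@avg_eq0_shift _ _ s (e c)) => //; last exact: char1_neq1.
move=> x; rewrite (HP (s x) x (xis x)); last by move=> k kD; exact: s_id.
rewrite xis sD mulrDr mulr1 e_add.
by rewrite mulrA mulrC.
Qed.

(** Expand the indicator into the characters e(a y); after multiplication by e(y) only a = -1
    survives. *)
Lemma block_code_corr_same (D d : nat) (xi : V -> V) (G : V -> C) :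
  block_code D d xi ->
  avg (fun x => (dot (xi x) x == 0)%:R * (G (xi x) * e (dot (xi x) x)))
  = p%:R^-1 * avg (fun x => G (xi x)).
Proof.
move=> xiP.
transitivity (avg (fun a => avg (fun x => G (xi x) * e ((a + 1) * dot (xi x) x)))).
  rewrite avg_exchange; apply: eq_avg => x.
  rewrite -(avg_charM e_add e_norm e_inj) mulrC -avgMl; apply: eq_avg => a.
  by rewrite mulrDl mul1r e_add; ring.
have S a : avg (fun x => G (xi x) * e ((a + 1) * dot (xi x) x))
    = if a == -1 then avg (fun x => G (xi x)) else 0.
  case: eqP => [->|/eqP a1].
    by apply: eq_avg => x; rewrite addNr mul0r (char0 e_add e_norm) mulr1.
  apply: (block_code_mean0 xiP); first by rewrite addr_eq0.
  by move=> x y ->.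
under eq_avg do rewrite S.
by rewrite {1}/avg -big_mkcond big_pred1_eq card_Fp// mulrC.
Qed.

(** Expand the indicator again and shift inside the later block: the earlier form and its block stay
    fixed, while the later form keeps its value and changes only its product with x. *)
Lemma block_code_corr_diff (D d D' d' : nat) (xi xi' : V -> V) (G : V -> C) :
  block_code D d xi -> block_code D' d' xi' ->
  (D' + d' <= D)%N || (D + d <= D')%N ->
  avg (fun x => (dot (xi' x) x == 0)%:R * (G (xi x) * e (dot (xi x) x))) = 0.
Proof.
move=> xiP xi'P DD.
transitivity (avg (fun a => avg (fun x =>
    G (xi x) * e (a * dot (xi' x) x) * e (1 * dot (xi x) x)))).
  rewrite avg_exchange; apply: eq_avg => x.
  rewrite -(avg_charM e_add e_norm e_inj) mulrC -avgMl; apply: eq_avg => a.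
  by rewrite mul1r; ring.
rewrite /avg big1 ?mul0r// => a _; rewrite -/(avg _).
have [xi_eq _ _ _] := xiP; have [xi'_eq _ _ _] := xi'P.
have [D'D|D'D] := leqP (D' + d') D.
  apply: (block_code_mean0 xiP); first exact: oner_neq0.
  move=> x y -> xy; congr (_ * e (_ * _)).
  rewrite (xi'_eq x y); last by move=> k kD; apply: xy; lia.
  by apply: dot_eq_on xi'P _ => k kD; apply: xy; lia.
have {DD}DD : (D + d <= D')%N by move: DD; rewrite leqNgt D'D.
(* For a = 0 the later character is trivial, so the shift is made in the block of [xi] instead. *)
have [->|a0] := eqVneq a 0.
  apply: (block_code_mean0 xiP); first exact: oner_neq0.
  by move=> x y ->; rewrite !mul0r.
rewrite (_ : avg _ = avg (fun x => (G (xi x) * e (dot (xi x) x)) *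
    e (a * dot (xi' x) x))); last first.
  by apply: eq_avg => x; rewrite mul1r mulrAC.
apply: (block_code_mean0 xi'P) => // x y _ xy.
rewrite (xi_eq x y); last by move=> k kD; apply: xy; lia.
by congr (_ * e _); apply: dot_eq_on xiP _ => k kD; apply: xy; lia.
Qed.

End LayerCorrelation.

(** * The subspace of the linear layer *)

Section LinearLayer.
Variables (p n : nat).
Hypothesis p_pr : prime p.
Local Notation V := 'rV['F_p]_n.

(** Over a prime field every scalar is an integer multiple of 1, so additivity implies linearity. *)
Lemma poly_phase1_dot (phi : V -> 'F_p) : poly_phase 1 phi ->
  exists y, forall x, phi x = dot y x + phi 0.
Proof.
move=> /poly_phase_affine phiE; pose L x := phi x - phi 0.
have LD x y : L (x + y) = L x + L y by rewrite /L -[phi y - _](phiE x) //; ring.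
have L0 : L 0 = 0 by rewrite /L subrr.
have LM m x : L (x *+ m) = L x *+ m.
  by elim: m => [|m IH]; rewrite ?mulr0n// !mulrS LD IH.
have LZ a x : L (a *: x) = a * L x.
  by rewrite -[a in a *: x]natr_Zp scaler_nat LM -mulr_natl natr_Zp.
exists (\row_k L (delta_mx 0 k)) => x; rewrite -[LHS](subrK (phi 0)) -/(L x).
congr (_ + _); rewrite {1}(row_sum_delta x) dotE.
have -> (r : seq 'I_n) (F : 'I_n -> V) : L (\sum_(i <- r) F i) = \sum_(i <- r) L (F i).
  by elim: r => [|i r IH]; rewrite ?big_nil// !big_cons LD IH.
by apply: eq_bigr => k _; rewrite LZ mxE mulrC.
Qed.

(** W is the common kernel of the linear parts. Constant polynomials impose no condition, so degree
    exactly 1 may be relaxed to degree at most 1 in the description of W. *)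
Lemma linear_layer_subspace (I : finType) (P : I -> V -> 'F_p) :
  exists W : {vspace V}, atoms (layer 1 P) = cosets W /\
    forall w, w \in W <-> forall i, degree_le 1 (P i) -> P i w = P i 0.
Proof.
have /choice[y yP] : forall i, exists y, degree_le 1 (P i) ->
    forall x, P i x = dot y x + P i 0.
  move=> i; have [Pi|] := pselect (degree_le 1 (P i)); last by exists 0.
  by have [y] := poly_phase1_dot (degree_le_phase (isT : 1 <= 2)%N Pi); exists y.
pose A := \matrix_(k < n, j < #|I|) if `[< degree_eq 1 (P (enum_val j)) >] then
  y (enum_val j) 0 k else 0.
pose W := lker (linfun (mulmxr A : V -> 'rV_#|I|)).
have eq1 i : degree_eq 1 (P i) -> degree_le 1 (P i) by case.
have WP w : w \in W <-> forall i, degree_eq 1 (P i) -> P i w = P i 0.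
  have wAE i : degree_eq 1 (P i) -> (w *m A) 0 (enum_rank i) = P i w - P i 0.
    move=> Pi; rewrite (yP i) ?addrK; last exact: eq1.
    rewrite mxE dotE; apply: eq_bigr => k _; rewrite mxE enum_rankK mulrC.
    by rewrite (asboolT Pi).
  rewrite memv_ker lfunE /=; split=> [/eqP wA i Pi|Pw].
    by apply/eqP; rewrite -subr_eq0 -wAE// wA mxE.
  apply/eqP/rowP => j; rewrite -(enum_valK j).
  have [Pi|Pi] := pselect (degree_eq 1 (P (enum_val j))).
    by rewrite wAE// Pw// subrr mxE.
  rewrite !mxE big1// => k _; rewrite mxE enum_rankK.
  by rewrite (asboolF Pi) mulr0.
have affP i : degree_eq 1 (P i) ->
    forall x h, P i (x + h) - P i x = P i h - P i 0.
  by move=> /eq1/(degree_le_phase (isT : 1 <= 2)%N)/poly_phase_affine.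
exists W; split.
  have atomE x : atom (layer 1 P) x = [set x + w | w in W].
    apply/setP => z; rewrite inE; apply/forallP/imsetP => [Pz|[w /WP Pw ->] i].
      exists (z - x); last by rewrite subrKC.
      apply/WP => i Pi; have /eqP := Pz (Sub i (asboolT Pi)); rewrite /layer /=.
      by move=> Pzx; apply/eqP; rewrite -subr_eq0 -(affP _ Pi x) subrKC Pzx subrr.
    have /asboolP Pi := valP i; rewrite /layer -subr_eq0 (affP _ Pi).
    by rewrite Pw// subrr.
  apply/setP => S; apply/imsetP/imsetP => -[x _ ->]; exists x => //.
move=> w; rewrite WP; split=> Pw i Pi; last by apply: Pw; exact: eq1.
have [Pi0|Pi0] := pselect (degree_le 0 (P i)).
  exact: (degree_le_phase (isT : 0 <= 2)%N Pi0 w 0).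
apply: Pw; split=> // k; rewrite ltnS leqn0 => /eqP ->.
exact: Pi0.
Qed.

(** W lies in the kernel of the projection to the first D coordinates, which is onto. *)
Lemma codim_ge (W : {vspace V}) D : (D <= n)%N ->
  (forall w, w \in W -> forall k : 'I_n, (k < D)%N -> w 0 k = 0) ->
  (D <= codim W)%N.
Proof.
move=> Dn W0; pose f := linfun (mulmxr (pid_mx D) : V -> 'rV['F_p]_D).
have Wf : (W <= lker f)%VS.
  apply/subvP => w /W0 wk; rewrite memv_ker lfunE /=; apply/eqP/rowP => k.
  rewrite !mxE (bigD1 (widen_ord Dn k))//= big1 ?addr0 => [|j jk].
    by rewrite wk ?mul0r//= ltn_ord.
  by rewrite mxE (_ : (j == k :> nat) = false) ?mulr0//; apply: contra_neqF jk
    => /eqP jk; apply: val_inj.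
have f_onto : limg f = fullv.
  apply/vspaceP => y; rewrite memvf -(_ : f (y *m pid_mx D) = y).
    by rewrite memv_img ?memvf.
  by rewrite lfunE /= -mulmxA mul_pid_mx minnn !(minn_idPr _) ?pid_mx_1 ?mulmx1.
have := limg_ker_dim f fullv; rewrite f_onto capfv !dimvf /dim /= !mul1n => fdim.
rewrite /codim; move: (dimvS Wf) fdim.
move: (\dim W) (\dim (lker f)) => a b; lia.
Qed.

End LinearLayer.

(** * The test function against a regularity partition *)

Section TestFunction.
Variables (R : realType) (p n : nat).
Hypothesis p_pr : prime p.
Local Notation V := 'rV['F_p]_n.
Local Notation C := R[i].

Lemma cond_exp_atom (f : V -> R) (I : finType) (P : I -> V -> 'F_p) x y :
  (forall i, P i x = P i y) -> cond_exp f P x = cond_exp f P y.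
Proof.
move=> Pxy; rewrite /cond_exp (_ : atom P x = atom P y)//; apply/setP => z.
by rewrite !inE; apply: eq_forallb => i; rewrite Pxy.
Qed.

Lemma cond_exp_itv (f : V -> R) (I : finType) (P : I -> V -> 'F_p) x :
  (forall x, 0 <= f x <= 1) -> 0 <= cond_exp f P x <= 1.
Proof.
move=> f01; rewrite /cond_exp divr_ge0 ?ler0n//=; last first.
  by apply: sumr_ge0 => y _; case/andP: (f01 y).
have A0 : (0 < #|atom P x|)%N.
  by apply/card_gt0P; exists x; rewrite inE; apply/forallP => i.
rewrite ler_pdivrMr ?ltr0n// mul1r -sum1_card natr_sum.
by apply: ler_sum => y _; case/andP: (f01 y).
Qed.

Lemma normc_real (a : R) : `|a%:C%C| = (`|a|)%:C%C :> C.
Proof. by rewrite normc_def /= expr0n addr0 sqrtr_sqr. Qed.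

Lemma norm_avg_le_L2norm (h : V -> R) (T : V -> C) : (forall x, `|T x| <= 1) ->
  `|avg (fun x => (h x)%:C%C * T x)| <= (L2norm h)%:C%C.
Proof.
move=> T1; apply: le_trans (ler_norm_avg _) _.
apply: (@le_trans _ _ (avg (fun x => (`|h x|)%:C%C : C))).
  by apply: ler_avg => x; rewrite normrM normc_real ler_piMr// ler0c normr_ge0.
have -> : avg (fun x => (`|h x|)%:C%C : C) = (avg (fun x => `|h x|))%:C%C.
  by rewrite /avg rmorphM rmorph_sum fmorphV rmorph_nat.
rewrite lecR /L2norm -[leLHS]ger0_norm; last by apply: avg_ge0.
by rewrite -sqrtr_sqr ler_wsqrtr// sqr_avg_le ?card_V_gt0.
Qed.

Variable e : 'F_p -> C.
Hypothesis e_add : {morph e : a b / a + b >-> a * b}.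
Hypothesis e_norm : forall a, `|e a| = 1.
Hypothesis e_inj : forall a, e a = 1 -> a = 0.

(** The three terms bound the contributions of [f_err], of the U^3-small part and of [cond_exp f P],
    in this order; p^#|I| counts the possible values of the factor. *)
Lemma test_correlation (f f_err : V -> R) (I : finType) (P : I -> V -> 'F_p)
    (r : nat) (beta : R) (W : {vspace V}) (xi : V -> V) (u : V) :
  (forall x, 0 <= f x <= 1) -> quadratic_factor P ->
  (r%:R%:E <= factor_rank R P)%E -> (0 < r)%N ->
  0 <= beta -> (p%:R ^+ r)^-1 <= beta ^+ 2 ->
  (forall w, w \in W <-> forall i, degree_le 1 (P i) -> P i w = P i 0) ->
  (forall x w, w \in W -> xi (x + w) = xi x) -> u \in W ->
  `|avg (fun x => (f x)%:C%C *
      ((dot (xi x) u != 0)%:R * e (dot (xi x) x)))|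
  <= (L2norm f_err + p%:R ^+ #|I| *
      U3norm (fun x => (f x - cond_exp f P x - f_err x)%:C%C)
      + p%:R ^+ #|I| * beta)%:C%C.
Proof.
move=> f01 P2 Pr r0 beta0 beta2 WP xiW uW.
pose G x : C := (dot (xi x) u != 0)%:R.
pose g x : C := (f x - cond_exp f P x - f_err x)%:C%C.
pose E (F : V -> C) := avg (fun x => F x * (G x * e (dot (xi x) x))).
have aff i : degree_le 1 (P i) -> forall x h, P i (x + h) - P i x = P i h - P i 0.
  by move=> /(degree_le_phase (isT : 1 <= 2)%N)/poly_phase_affine.
(* Points of one atom differ by an element of W. *)
have xi_atom x y : (forall i, P i x = P i y) -> xi x = xi y.
  move=> Pxy; rewrite -[x in LHS](subrKC y) xiW//; apply/WP => i Pi.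
  by apply/eqP; rewrite -subr_eq0 -(aff i Pi y) subrKC Pxy subrr.
have Pu i z : degree_le 1 (P i) -> P i (z + u) = P i z.
  move=> Pi; apply/eqP; rewrite -subr_eq0 aff//.
  by move/WP: uW => /(_ i Pi) ->; rewrite subrr.
have G1 x : `|G x| <= 1 by rewrite normr_nat lern1 leq_b1.
have T1 x : `|G x * e (dot (xi x) x)| <= 1 by rewrite normrM e_norm mulr1.
have -> : avg (fun x => (f x)%:C%C * ((dot (xi x) u != 0)%:R * e (dot (xi x) x)))
   = E (fun x => (f_err x)%:C%C) + E g + E (fun x => (cond_exp f P x)%:C%C).
  rewrite /E -!avgD; apply: eq_avg => x; rewrite -!mulrDl -!rmorphD /=.
  by congr (_%:C%C * _); ring.
rewrite !rmorphD !rmorphM /= rmorphXn rmorph_nat.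
apply: le_trans (ler_normD _ _) (lerD _ _).
  apply: le_trans (ler_normD _ _) (lerD _ _); first exact: norm_avg_le_L2norm.
  rewrite (_ : E g = avg (fun x => G x * g x * e (dot (xi x) x))); last first.
    by apply: eq_avg => x; rewrite mulrCA mulrA.
  apply: (@factor_correlation p n p_pr C e e_add e_norm e_inj I P G g xi).
  - by rewrite U3norm_gowers ler0c powR_ge0.
  - by move=> x y /xi_atom Pxy; rewrite /G Pxy.
  - exact: G1.
  move=> x mu _.
  have phi2 : poly_phase 2 (fun z => \sum_i mu i * P i z + dot (xi x) z).
    apply: poly_phaseD; last exact/poly_phaseS/poly_phase_dot.
    by apply: poly_phase_sum => i; apply: poly_phaseZ; exact: degree_le_phase.
  exact: (U3norm_correlation g e_add e_norm phi2).
(* The conditional expectation is constant on atoms, so it joins the amplitude and leaves pure phase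
   averages with [g] equal to 1. *)
rewrite (_ : E _ = avg (fun x => ((cond_exp f P x)%:C%C * G x) * 1
   * e (dot (xi x) x))); last by apply: eq_avg => x; rewrite mulr1 mulrA.
apply: (@factor_correlation p n p_pr C e e_add e_norm e_inj I P
  (fun x => (cond_exp f P x)%:C%C * G x) (fun=> 1) xi beta%:C%C).
- by rewrite ler0c.
- move=> x y Pxy; rewrite /G (xi_atom _ _ Pxy).
  by rewrite (cond_exp_atom _ Pxy).
- move=> x; have /andP[c0 c1] := cond_exp_itv P x f01.
  rewrite normrM (le_trans (ler_piMr _ (G1 x)))//.
  by rewrite normc_real ger0_norm// -[1](rmorph1 (real_complex R)) lecR.
(* The cutoff in the test function leaves only characters nontrivial on u, as the Gauss sum bound
   requires. *)
move=> x mu; rewrite /G; have [xu|xu _] := eqVneq (dot (xi x) u) 0.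
  by rewrite /= mulr0n mulr0 eqxx.
rewrite -ler_sqr ?nnegrE ?normr_ge0 ?ler0c//.
under eq_avg do rewrite mul1r.
apply: le_trans (quadratic_factor_gauss_sum p_pr e_add e_norm e_inj mu P2 Pr r0 _ xu) _.
  by move=> i z; exact: Pu.
have -> : (p%:R ^+ r)^-1 = ((p%:R ^+ r)^-1)%:C%C :> C.
  by rewrite fmorphV rmorphXn rmorph_nat.
by rewrite -[leRHS](rmorphXn (real_complex R)) lecR.
Qed.

Lemma layered_correlation (s i : nat) (D d : nat -> nat) (xi : nat -> V -> V) u :
  (i < s)%N ->
  (forall j, (j < s)%N -> block_code (D j) (d j) (xi j)) ->
  (forall j k, (j < k)%N -> (D j + d j <= D k)%N) ->
  avg (fun x =>
    ((\sum_(j < s) (dot (xi j x) x == 0)%:R) / s%:R : R)%:C%C *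
      ((dot (xi i x) u != 0)%:R * e (dot (xi i x) x)))
  = (#|[set x | dot (xi i x) u != 0]|%:R / #|{: V}|%:R / p%:R / s%:R : R)%:C%C.
Proof.
move=> si xiP Dd.
pose G (v : V) : C := (dot v u != 0)%:R.
pose S j := avg (fun x => (dot (xi j x) x == 0)%:R * (G (xi i x) * e (dot (xi i x) x))).
transitivity (s%:R^-1 * \sum_(j < s) S j).
  rewrite -avg_sum -avgMl; apply: eq_avg => x.
  rewrite rmorphM fmorphV rmorph_nat rmorph_sum /= -mulr_suml.
  under eq_bigr do rewrite rmorph_nat.
  by ring.
rewrite (bigD1 (Ordinal si))//= big1 ?addr0 => [|j ji]; last first.
  apply: block_code_corr_diff => //; [exact: xiP|exact: xiP|].
  by have [/Dd->//|/Dd->|] := ltngtP j i; rewrite ?orbT// => jE;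
    case/eqP: ji; apply: val_inj.
rewrite /S (block_code_corr_same p_pr e_add e_norm e_inj G (xiP i si)).
rewrite /G (_ : avg _ = avg (fun x => (x \in [set x | dot (xi i x) u != 0])%:R : C)).
  rewrite avg_indicator !rmorphM !fmorphV !rmorph_nat /=; ring.
by apply: eq_avg => x; rewrite inE.
Qed.

End TestFunction.

(** * Comparison of the constants *)

Section Numerics.
Variable R : realType.
Implicit Types (delta eta : R) (p t D r : nat).

(** The rank hypothesis is the logarithm of this bound. The value eta / p^(D+1) is chosen so that
    eta / p remains after summing over p^D level sets. *)
Lemma gauss_sum_threshold p D r eta : prime p -> 0 < eta <= 1 ->
  2%:R * (D%:R + 1 + ln eta^-1 / ln p%:R) <= r%:R ->
  (0 < r)%N /\ (p%:R ^+ r)^-1 <= (eta / p%:R ^+ D.+1) ^+ 2.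
Proof.
move=> p_pr /andP[eta0 eta1] rD.
have p0 : 0 < p%:R :> R by rewrite ltr0n prime_gt0.
have lnp : 0 < ln p%:R :> R by rewrite ln_gt0// ltr1n prime_gt1.
have lneta : 0 <= ln eta^-1 by rewrite ln_ge0// invf_ge1.
have r2 : 2 <= r%:R :> R.
  apply: le_trans rD; rewrite ler_pMr//.
  by rewrite -addrA addrC -addrA lerDl addr_ge0 ?divr_ge0// ltW.
split; first by rewrite -(ltr_nat R) (lt_le_trans _ r2)// mulr0n.
have q0 : 0 < eta / p%:R ^+ D.+1 by rewrite divr_gt0 ?exprn_gt0.
set q := eta / _ in q0 *.
rewrite -[leRHS]invrK lef_pV2 ?posrE ?invr_gt0 ?exprn_gt0// -exprVn /q invf_div.
rewrite -ler_ln ?posrE ?exprn_gt0 ?divr_gt0 ?exprn_gt0//.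
rewrite !lnXn ?divr_gt0 ?exprn_gt0// lnM ?posrE ?exprn_gt0 ?invr_gt0//.
rewrite lnXn// -[_ *+ r]mulr_natl.
apply: le_trans (ler_wpM2r (ltW lnp) rD).
rewrite [leLHS](_ : _ = 2 * (D%:R + 1 + ln eta^-1 / ln p%:R) * ln p%:R)//.
rewrite -[_ *+ D.+1]mulr_natl mulr2n -natr1.
by field; rewrite gt_eqF.
Qed.

(** Multiplied by 2pt, the left side is 2 (p t eta)(eta^2 + eta + 1/p) <= 2/60, below 1/8; here eta
    <= 1/60 and 1/p <= 1/2. *)
Lemma oscillation_too_large p t eta : (1 < p)%N -> (0 < t)%N -> 0 < eta ->
  (60 * p)%:R * t%:R * eta <= 1 ->
  eta ^+ 3 + eta ^+ 2 + eta / p%:R < 8%:R^-1 / p%:R / (2 * t)%:R.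
Proof.
move=> p1 t0 eta0 small.
have p0 : 0 < p%:R :> R by rewrite ltr0n ltnW.
have p2 : 2 <= p%:R :> R by rewrite ler_nat.
have t1 : 1 <= t%:R :> R by rewrite ler1n.
have t0' : 0 < t%:R :> R by rewrite ltr0n.
rewrite -[_ / (2 * t)%:R]mulrA -invfM ltr_pdivlMr; last first.
  by rewrite mulr_gt0// natrM mulr_gt0.
set x := eta ^+ 3 + _ + _.
have -> : x * (p%:R * (2 * t)%:R)
    = 2 * (p%:R * t%:R * eta) * (eta ^+ 2 + eta + p%:R^-1).
  by rewrite /x natrM; field; rewrite gt_eqF.
move: small; rewrite natrM => small.
have X : p%:R * t%:R * eta <= 60^-1 by lra.
have pt : 1 <= p%:R * t%:R :> R by rewrite -[1]mulr1 ler_pM//; lra.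
have e60 : eta <= 60^-1 by apply: le_trans X; rewrite ler_peMl// ltW.
have pV : p%:R^-1 <= 2^-1 :> R by rewrite lef_pV2 ?posrE.
have pV0 : 0 <= p%:R^-1 :> R by rewrite invr_ge0 ltW.
have Y : eta ^+ 2 + eta + p%:R^-1 <= 1 by nra.
have X0 : 0 <= p%:R * t%:R * eta by rewrite !mulr_ge0 ?ltW.
apply: (@le_lt_trans _ _ (2 * (p%:R * t%:R * eta))); last by lra.
by rewrite ler_piMr// mulr_ge0.
Qed.

End Numerics.

(** * The lower bound on the codimension *)

Theorem theoremB (R : realType) (p : nat) (p_prime : prime p)
  (delta : R) (delta_gt0 : 0 < delta) (omega rho : nat -> nat)
  (omega_mono : {homo omega : c d / (c <= d)%N})
  (rho_mono : {homo rho : c d / (c <= d)%N})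
  (omega_ge : forall d : nat,
     delta `^ (- (2%:R / 3%:R)) * p%:R ^+ d <= (omega d)%:R)
  (rho_ge : forall d : nat,
     2%:R * (d%:R + 1 + ln (delta `^ (- (1 / 3%:R))) / ln p%:R)
       <= (rho d)%:R) :
  exists n0 : nat, forall n : nat, (n0 <= n)%N ->
    exists f : 'rV['F_p]_n -> R,
      (forall x, 0 <= f x <= 1) /\
      forall (D : nat) (P : 'I_D -> 'rV['F_p]_n -> 'F_p),
        quadratic_regularity_partition delta omega rho f P ->
        exists W : {vspace 'rV['F_p]_n},
          atoms (layer 1 P) = cosets W /\
          (twr (Num.floor (delta `^ (- (1 / 3%:R)) / (60 * p)%:R) - 1)
             <= codim W)%N.
Proof.
have p1 := prime_gt1 p_prime; have p0 := prime_gt0 p_prime.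
set eta := delta `^ (1 / 3%:R).
have eta0 : 0 < eta by exact: powR_gt0.
have eta3 : delta = eta ^+ 3.
  by rewrite -powR_mulrn ?ltW// -powRrM mulfVK ?pnatr_eq0// powRr1// ltW.
have etaV : delta `^ (- (1 / 3%:R)) = eta^-1 by rewrite powRN.
have eta2V : delta `^ (- (2%:R / 3%:R)) = (eta ^+ 2)^-1.
  by rewrite powRN -powR_mulrn ?ltW// -powRrM mulrC mul1r.
move: omega_ge rho_ge; rewrite etaV eta2V => omega_ge rho_ge.
have [t tE] : exists t, Num.floor (eta^-1 / (60 * p)%:R) = Posz t.
  have : 0 <= Num.floor (eta^-1 / (60 * p)%:R).
    by rewrite floor_ge0 divr_ge0 ?invr_ge0 ?ler0n// ltW.
  by case: (Num.floor _) => // t _; exists t.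
rewrite tE; exists (layer_dim (2 * t)) => n n_ge.
have [xi xiP] := exists_layers p_prime n_ge.
pose f x : R := (\sum_(j < 2 * t) (dot (xi j x) x == 0)%:R) / (2 * t)%:R.
have f01 x : 0 <= f x <= 1.
  (* For t = 0 division by zero makes f the zero function. *)
  rewrite /f divr_ge0 ?sumr_ge0//=; have [->|t_gt0] := posnP (2 * t).
    by rewrite invr0 mulr0.
  rewrite ler_pdivrMr ?ltr0n// mul1r -[(2 * t)%:R](_ : \sum_(j < 2 * t) 1 = _).
    by apply: ler_sum => j _; rewrite lern1 leq_b1.
  by rewrite sumr_const card_ord.
exists f; split=> // D P [P2 Prank [f_err [f_err1 f_errL2 f_errU3]]].
have [W [WE WP]] := linear_layer_subspace P; exists W; split=> //.
apply: leq_trans (twr_layer_dim t) _.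
apply: codim_ge => //.
suff step i : (i <= 2 * t)%N -> forall w, w \in W ->
    forall k : 'I_n, (k < layer_dim i)%N -> w 0 k = 0.
  exact: step (leqnn _).
(* Block by block: W vanishes on the first i blocks, so [xi i] is invariant under W, and u in W is
   supposed nonzero in block i. *)
elim: i => [//|i IH] it u uW k ki; apply/eqP; apply: contraT => uk.
have {}IH := IH (ltnW it).
have ki' : (layer_dim i <= k < layer_dim i + 2 ^ (layer_dim i - 3))%N.
  by rewrite ki andbT leqNgt; apply: contra uk => /(IH u uW) ->.
have t0 : (0 < t)%N by case: (t) it => //; rewrite muln0.
have small : (60 * p)%:R * t%:R * eta <= 1.
  have : t%:R <= eta^-1 / (60 * p)%:R :> R.
    by have := floor_le_tmp (eta^-1 / (60 * p)%:R); rewrite tE.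
  rewrite ler_pdivlMr ?ltr0n ?muln_gt0 ?p0// => h.
  by rewrite -ler_pdivlMr// div1r [leLHS]mulrC.
have eta1 : eta <= 1.
  have pt1 : 1 <= (60 * p)%:R * t%:R :> R by rewrite -natrM ler1n !muln_gt0 p0.
  by apply: le_trans small; rewrite ler_peMl// ltW.
have [|r0 beta2] := gauss_sum_threshold p_prime _ (rho_ge D); first by rewrite eta0.
set beta := eta / _ in beta2.
have beta0 : 0 <= beta by rewrite divr_ge0 ?exprn_ge0// ltW.
have [e [e_add e_norm e_inj]] := exists_character p_prime R[i].
have [xi_eq _ _ xi_dist] := xiP i it.
have xiW x w : w \in W -> xi i (x + w) = xi i x.
  by move=> wW; apply: xi_eq => j ji; rewrite mxE (IH w wW j ji) addr0.
have := test_correlation p_prime e_add e_norm e_inj f_err f01 P2 Prank r0 beta0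
  beta2 WP xiW uW.
rewrite (layered_correlation p_prime e_add e_norm e_inj u it xiP); last first.
  by move=> a b ab; exact: (layer_dim_mono ab).
rewrite normc_real lecR ler_norml => /andP[_].
(* It remains to contradict the upper bound: by the code distance the correlation is at least 1/8 *
   1/p * 1/(2t). *)
rewrite leNgt card_ord => /negP[].
have := oscillation_too_large p1 t0 eta0 small.
set U := U3norm _ in f_errU3 *; set A := #|_|%:R / _.
have A8 : 8%:R^-1 <= A.
  rewrite ler_pdivlMr ?ltr0n ?card_V_gt0// mulrC ler_pdivrMr// -natrM ler_nat.
  by rewrite mulnC; exact: xi_dist ki' uk.
have omega0 : 0 < (omega D)%:R :> R.
  apply: lt_le_trans (omega_ge D); rewrite mulr_gt0 ?invr_gt0 ?exprn_gt0//.
  by rewrite ltr0n.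
have pD : 0 < p%:R ^+ D :> R by rewrite exprn_gt0// ltr0n.
(* The growth of [omega] cancels the p^D lost in expanding over atoms. *)
have pU : p%:R ^+ D * U <= eta ^+ 2.
  apply: (@le_trans _ _ (p%:R ^+ D / (omega D)%:R)).
    by rewrite ler_wpM2l// ltW.
  rewrite ler_pdivrMr// mulrC -ler_pdivrMr ?exprn_gt0//.
  by rewrite mulrC; exact: omega_ge.
have pbeta : p%:R ^+ D * beta = eta / p%:R.
  by rewrite /beta exprSr invfM mulrCA mulVKf ?gt_eqF.
have AA : 8^-1 / p%:R / (2 * t)%:R <= A / p%:R / (2 * t)%:R.
  by rewrite !ler_wpM2r// invr_ge0 ler0n.
rewrite pbeta => osc.
apply: lt_le_trans AA; apply: le_lt_trans osc.
by rewrite lerD2r lerD// -eta3 ltW.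
Qed.
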